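(* Let $0\le\zeta^{in}\in L^1_{0,1}$, let $\varphi\in L^1_{0,1}$, and let $\mathcal{A}:\mathbb{R}_{>0}^3\to[0,\infty)$ be a measurable function with $\mathcal{A}(x,y;z)=0$ whenever $z>x$, satisfying, for some $A\ge 0$, $$\mathcal{A}(x,y;z)\le A(1+x)^{1/2}(1+y)^{1/2}\varphi(z)\quad\text{for all }(x,y,z)\in\mathbb{R}_{>0}^3 .$$ Let $\zeta$ be a weak solution (in the sense defined in the context) to the continuous generalized exchange-driven growth equation with kernel $\mathcal{A}$ and initial condition $\zeta^{in}$. Then $\zeta$ is the unique weak solution to this initial value problem.
   Context: $\mathbb{R}_{>0}=(0,\infty)$, and $L^1_{0,1}=L^1(\mathbb{R}_{>0},(1+x)\,dx)$ with its standard norm. $\mathcal{C}([0,\infty),w\text{-}L^1(\mathbb{R}_{>0}))$ is the set of functions from $[0,\infty)$ to $L^1(\mathbb{R}_{>0})$ that are continuous for the weak topology of $L^1(\mathbb{R}_{>0})$. The continuous generalized exchange-driven growth equation is, for $x>0$, $t\ge0$, $$\begin{aligned}\partial_t\zeta(t,x)=&\int_0^\infty\!\!\int_0^\infty \mathcal{A}(x+z,y;z)\zeta(t,x+z)\zeta(t,y)\,dy\,dz-\int_0^\infty\!\!\int_z^\infty \mathcal{A}(y,x;z)\zeta(t,y)\zeta(t,x)\,dy\,dz\\&+\int_0^x\!\!\int_z^\infty \mathcal{A}(y,x-z;z)\zeta(t,y)\zeta(t,x-z)\,dy\,dz-\int_0^x\!\!\int_0^\infty \mathcal{A}(x,y;z)\zeta(t,x)\zeta(t,y)\,dy\,dz,\end{aligned}$$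 with $\zeta(0,x)=\zeta^{in}(x)\ge 0$ a.e. Weak solution: given $0\le\zeta^{in}\in L^1_{0,1}$, a function $\zeta$ is a weak solution if (a) $0\le\zeta\in\mathcal{C}([0,\infty),w\text{-}L^1(\mathbb{R}_{>0}))\cap L^\infty(0,T;L^1_{0,1})$ for every $T>0$; and (b) for every $t\ge0$ and every smooth $\omega\in L^\infty(\mathbb{R}_{>0})$, $$\int_0^\infty\omega(x)[\zeta(t,x)-\zeta^{in}(x)]\,dx=\int_0^t\int_0^\infty\int_0^\infty\int_0^x\tilde\omega(x,y,z)\,\mathcal{A}(x,y;z)\,\zeta(s,x)\,\zeta(s,y)\,dz\,dy\,dx\,ds,$$ where $\tilde\omega(x,y,z)=\omega(y+z)+\omega(x-z)-\omega(x)-\omega(y)$. *)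

(* Defs.v *)
From HB Require Import structures.
From mathcomp Require Import all_boot all_order all_algebra.
From mathcomp Require Import all_classical all_reals all_analysis.
Set Implicit Arguments.
Unset Strict Implicit.
Unset Printing Implicit Defensive.
Import Order.TTheory GRing.Theory Num.Theory.
Import numFieldNormedType.Exports.
Local Open Scope classical_set_scope.
Local Open Scope ring_scope.

(* Elements of L^1 spaces are represented by (Borel) functions R -> R, of which
   only the values on ]0, +oo[ matter; equality in L^1 is equality almost
   everywhere on ]0, +oo[. *)

Definition Rpos (R : realType) : set R := `]0, +oo[.
Arguments Rpos R : clear implicits.

Definition in_L1 (R : realType) (f : R -> R) : Prop :=
  (@lebesgue_measure R).-integrable (Rpos R) (EFin \o f).

Definition normL1 (R : realType) (f : R -> R) : \bar R :=
  \int[@lebesgue_measure R]_(x in Rpos R) `|f x|%:E.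

(* L^1(]0, +oo[, (1 + x) dx) *)
Definition in_L101 (R : realType) (f : R -> R) : Prop :=
  in_L1 (fun x => (1 + x) * f x).

Definition normL101 (R : realType) (f : R -> R) : \bar R :=
  \int[@lebesgue_measure R]_(x in Rpos R) ((1 + x) * `|f x|)%:E.

Definition in_Linfty (R : realType) (f : R -> R) : Prop :=
  measurable_fun (Rpos R) f /\
  exists M : R, {ae @lebesgue_measure R, forall x : R, 0 < x -> `|f x| <= M}.

Definition ae_eq_pos (R : realType) (f g : R -> R) : Prop :=
  {ae @lebesgue_measure R, forall x : R, 0 < x -> f x = g x}.

Definition ae_nonneg (R : realType) (f : R -> R) : Prop :=
  {ae @lebesgue_measure R, forall x : R, 0 < x -> 0 <= f x}.

(* Continuous linear functionals on L^1. By linearity, the bound forces [l] to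
   take the same value on functions that are equal almost everywhere. *)
Definition L1_dual (R : realType) (l : (R -> R) -> R) : Prop :=
  (forall (a : R) (f g : R -> R), in_L1 f -> in_L1 g ->
     l (fun x => a * f x + g x) = a * l f + l g) /\
  (exists C : R, forall f : R -> R, in_L1 f ->
     (`|l f|%:E <= C%:E * normL1 f)%E).

(* C([0, +oo[, w-L^1) *)
Definition weakly_continuous_L1 (R : realType) (u : R -> R -> R) : Prop :=
  (forall t : R, 0 <= t -> in_L1 (u t)) /\
  (forall l : (R -> R) -> R, L1_dual l ->
     {within `[0, +oo[, continuous (fun t : R => l (u t))}).

(* Measurable functions of time with finitely many values, all in L^1_{0,1}. *)
Definition simple_L101 (R : realType) (s : R -> R -> R) : Prop :=
  exists (N : nat) (E : 'I_N -> set R) (f : 'I_N -> R -> R),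
    [/\ forall i, measurable (E i),
        forall i, in_L101 (f i) &
        s = (fun t x => \sum_(i < N) \1_(E i) t * f i x)].

(* Bochner space L^oo(0, T; L^1_{0,1}): strongly measurable functions of time
   with an essentially bounded norm. *)
Definition strongly_measurable_L101 (R : realType) (T : R) (u : R -> R -> R)
    : Prop :=
  exists s : nat -> R -> R -> R,
    (forall n, simple_L101 (s n)) /\
    {ae @lebesgue_measure R, forall t : R, 0 < t < T ->
       (fun n => normL101 (fun x => s n t x - u t x)) @ \oo --> 0%E}.

Definition in_Linfty_L101 (R : realType) (T : R) (u : R -> R -> R) : Prop :=
  [/\ {ae @lebesgue_measure R, forall t : R, 0 < t < T -> in_L101 (u t)},
      strongly_measurable_L101 T u &
      exists C : R, {ae @lebesgue_measure R, forall t : R, 0 < t < T ->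
        (normL101 (u t) <= C%:E)%E}].

Definition smooth_pos (R : realType) (w : R -> R) : Prop :=
  forall (n : nat) (x : R), 0 < x -> derivable (derive1n n w) x 1.

Definition wtilde (R : realType) (w : R -> R) (x y z : R) : R :=
  w (y + z) + w (x - z) - w x - w y.

(* [K x y z] is the kernel A(x, y; z). *)
Definition weak_solution (R : realType) (K : R -> R -> R -> R)
    (zin : R -> R) (u : R -> R -> R) : Prop :=
  let mu := @lebesgue_measure R in
  [/\ forall t : R, 0 <= t -> ae_nonneg (u t),
      weakly_continuous_L1 u,
      forall T : R, 0 < T -> in_Linfty_L101 T u &
      forall (t : R) (w : R -> R), 0 <= t -> smooth_pos w -> in_Linfty w ->
        (\int[mu]_(x in Rpos R) (w x * (u t x - zin x))%:E =
         \int[mu]_(s in `[0%R, t])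
           \int[mu]_(x in Rpos R)
             \int[mu]_(y in Rpos R)
               \int[mu]_(z in `]0%R, x[)
                 (wtilde w x y z * K x y z * u s x * u s y)%:E)%E].

(* Main.v *)
Require Import Defs.
From HB Require Import structures.
From mathcomp Require Import all_boot all_order all_algebra.
From mathcomp Require Import all_classical all_reals all_analysis.
From mathcomp Require Import measurable_realfun ring lra.
Import Order.TTheory GRing.Theory Num.Theory.
Import numFieldNormedType.Exports.
Local Open Scope classical_set_scope.
Local Open Scope ring_scope.
Set Implicit Arguments.
Unset Strict Implicit.

(** Let zeta and xi be two weak solutions with the same initial datum, let
E = zeta - xi, and let g(t) be the integral of (1 + x)^(1/2) |E(t, x)|.  The
claim is that g vanishes, because g' <= C g formally.  To see this, test the
equation with w(x) = (1 + x)^(1/2) sgn E(t, x), and write the difference of the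
quadratic terms as E(x) zeta(y) + xi(x) E(y).  In the first term, the kernel and
the weight together produce a factor 1 + x in front of |E(x)|, which g does not
control, but only through w(x - z) E(x) - w(x) E(x); this is nonpositive since
the weight increases and w(x) E(x) = (1 + x)^(1/2) |E(x)|.  What remains of the
weights is at most 3 (1 + y)^(1/2) (1 + z)^(1/2), and the factors y and z are
absorbed by the first moments of zeta and phi.  The second term is treated in the
same way with the roles of x and y exchanged, where w(y + z) E(y) - w(y) E(y)
causes no loss because the square root is subadditive.  These bounds are
[wtilde_signed_weightl] and [wtilde_signed_weightr], integrated in
[exchange_signed_weightl] and [exchange_signed_weightr].

Several points make the formal computation rigorous.

The function w is neither bounded nor smooth.  The square root is replaced by
min((1 + x)^(1/2), n), which is still increasing and subadditive, so the bounds do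
not depend on n.  The equation extends from smooth to all bounded measurable test functions
([weak_eq_bounded]) by a functional monotone class argument
([functional_monotone_class]): both sides are linear in w and continuous along
bounded pointwise limits, and indicators of rays are limits of the smooth
Gompertz functions exp(- exp(k x + m)).

The chain rule for |E| in time is avoided by discretizing.  On a short step
[s, t], testing with w built from E(t) gives an upper bound of the increment of
the capped integral of |E|, since w(x) E(s, x) is at most the capped weight times
|E(s, x)|.  At a time r of the step, replacing E(r) by E(t) costs an error that
tends to 0 with the length of the step: E is Lipschitz in L^1 ([lipschitz_L1],
obtained by testing with sgn (E(t) - E(s))), and interpolation with the bounded
first moments makes it uniformly continuous for the half moment
([half_moment_uniformly_continuous]).  Adding the steps
([le_increment_of_local]), letting n tend to infinity and iterating over short
time intervals ([gronwall_zero]) yields g = 0.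

Integrals in time require measurability of s |-> B(u(s), u(s)), where B is the
trilinear form [exchange] with w fixed.  Weak continuity gives it for the pairing
of u(s) with a fixed bounded function, and monotone classes transport it to
tensor products ([measurable_pairings_tensor], [measurable_exchange]).  Weak
continuity also upgrades the bound on the first moment from almost all times to
all times ([solution_moment]). *)

(** * A functional monotone class theorem *)

Definition bounded_mfun d (T : measurableType d) (R : realType) (f : T -> R) :=
  measurable_fun setT f /\ exists M : R, forall x, `|f x| <= M.

Lemma bounded_indic d (T : measurableType d) (R : realType) (A : set T) :
  measurable A -> bounded_mfun (\1_A : T -> R).
Proof.
move=> mA; split; first exact: measurable_indic.
by exists 1 => x; rewrite indicE ger0_norm// lern1 leq_b1.
Qed.

Section functional_monotone_class.
Context d (T : measurableType d) (R : realType).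
Variables (G : set (set T)) (P : (T -> R) -> Prop).
Hypothesis GE : @measurable _ T = <<s G >>.
Hypothesis GI : setI_closed G.
Hypothesis PG : forall A, G A -> P \1_A.
Hypothesis P1 : P (cst 1).
Hypothesis Plin : forall (a : R) (f g : T -> R), bounded_mfun f -> bounded_mfun g ->
  P f -> P g -> P (fun x => a * f x + g x).
Hypothesis Plim : forall (f_ : nat -> T -> R) (f : T -> R) (M : R),
  (forall n, measurable_fun setT (f_ n)) -> (forall n x, `|f_ n x| <= M) ->
  (forall x, f_ ^~ x @ \oo --> f x) -> (forall n, P (f_ n)) -> P f.

Let bm_cst (a : R) : bounded_mfun (cst a : T -> R).
Proof. by split; [exact: measurable_cst|exists `|a| => x]. Qed.

Let bm_lin (a : R) (f g : T -> R) : bounded_mfun f -> bounded_mfun g ->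
  bounded_mfun (fun x => a * f x + g x).
Proof.
move=> [mf [M fM]] [mg [N gN]]; split.
  by apply: measurable_funD => //; apply: measurable_funM.
exists (`|a| * M + N) => x.
by rewrite (le_trans (ler_normD _ _))// lerD// normrM ler_wpM2l.
Qed.

Let P_eq (f g : T -> R) : f =1 g -> P f -> P g.
Proof. by move=> /funext ->. Qed.

Let P0 : P (cst 0).
Proof.
by apply: (P_eq _ (Plin (-1) (bm_cst 1) (bm_cst 1) P1 P1)) => x /=; ring.
Qed.

Let P_indic (A : set T) : measurable A -> P \1_A.
Proof.
rewrite GE; apply: (dynkin_induction (G := G) (P := fun A => P \1_A)) => //.
- by apply: P_eq P1 => x; rewrite indicT.
- move=> S mS PS.
  apply: (P_eq _ (Plin (-1) (bounded_indic R mS) (bm_cst 1) PS P1)) => x.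
  by rewrite !indicE in_setC; case: (x \in S) => /=; rewrite /cst; ring.
- move=> F mF tF PF.
  pose B n := \big[setU/set0]_(k < n) F k.
  have mB n : measurable (B n) by exact: bigsetU_measurable.
  have PB n : P \1_(B n).
    elim: n => [|n IH].
      by apply: P_eq P0 => x; rewrite /B big_ord0 indic0.
    apply: (P_eq _ (Plin (1) (bounded_indic R (mF n)) (bounded_indic R (mB n)) (PF n) IH)).
    move=> x; rewrite /B big_ord_recr/= -/(B n) mul1r !indicE in_setU.
    case: (boolP (x \in F n)) => xF; case: (boolP (x \in B n)) => xB /=;
      rewrite ?addr0 ?add0r//.
    move: xB xF; rewrite !inE /B -bigcup_mkord => -[k /= kn Fk] Fn.
    have := tF k n Logic.I Logic.I (ex_intro _ x (conj Fk Fn)).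
    by move=> kne; rewrite kne ltnn in kn.
  apply: (Plim (f_ := fun n => \1_(B n)) (M := 1)) => //.
  + by move=> n x; rewrite indicE ger0_norm// lern1 leq_b1.
  + move=> x; have [xF|xF] := boolP (x \in \bigcup_k F k).
      have [k _ Fk] := set_mem xF.
      apply: cvg_near_cst; exists k.+1 => // n /= kn.
      rewrite !indicE xF mem_set// /B -bigcup_mkord.
      by exists k.
    apply: cvg_near_cst; apply: nearW => n; rewrite !indicE (negbTE xF) memNset//.
    move=> Bx; move: xF; rewrite notin_setE; apply.
    by move: Bx; rewrite /B -bigcup_mkord => -[k _ Fk]; exists k.
Qed.

Let P_sum (I : Type) (s : seq I) (a : I -> R) (A : I -> set T) :
  (forall i, measurable (A i)) ->
  P (fun x => \sum_(i <- s) a i * \1_(A i) x) /\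
  bounded_mfun (fun x => \sum_(i <- s) a i * \1_(A i) x).
Proof.
move=> mA; elim: s => [|i s [IH1 IH2]].
  have E : (fun x => \sum_(i <- [::]) a i * \1_(A i) x) = cst 0.
    by apply/funext => x; rewrite big_nil.
  by rewrite E; split; [exact: P0|exact: bm_cst].
split.
  apply: (P_eq _ (Plin (a i) (bounded_indic R (mA i)) IH2 (P_indic (mA i)) IH1)).
  by move=> x; rewrite big_cons.
rewrite (_ : (fun x => _) =
    fun x => a i * \1_(A i) x + \sum_(j <- s) a j * \1_(A j) x).
  exact: (bm_lin (a i) (bounded_indic R (mA i)) IH2).
by apply/funext => x; rewrite big_cons.
Qed.

Import HBNNSimple.

Let P_nonneg (f : T -> R) (M : R) : measurable_fun setT f ->
  (forall x, 0 <= f x <= M) -> P f.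
Proof.
move=> mf fM.
have mEf : measurable_fun setT (EFin \o f) by exact/measurable_EFinP.
pose g := nnsfun_approx measurableT mEf.
have f0 x : setT x -> (0 <= (EFin \o f) x)%E.
  by move=> _; rewrite lee_fin; case/andP: (fM x).
have gf x : g ^~ x @ \oo --> f x.
  have h := cvg_nnsfun_approx measurableT mEf f0 (x := x) Logic.I.
  have := fine_cvg h; exact.
have gle n x : 0 <= g n x <= f x.
  rewrite fun_ge0/=; rewrite /g nnsfun_approxE -lee_fin.
  exact: (@le_approx _ _ _ setT (EFin \o f)).
apply: (Plim (f_ := g) (M := M)) => //.
- move=> n x; have /andP[g0 gf'] := gle n x; have /andP[_ fM'] := fM x.
  by rewrite ger0_norm// (le_trans gf').
- move=> n; have [] := P_sum (finmap.enum_fset (fset_set (range (g n)))) id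
    (A := fun y => g n @^-1` [set y]).
    by move=> y; exact: measurable_funPTI.
  move=> + _; apply: P_eq => x; rewrite [RHS]fimfunE fsbig_finite//.
Qed.

(** Closure under complements and disjoint unions turns the hypotheses on the
pi-system [G] into a statement about all measurable indicators; simple functions
follow by linearity, and bounded measurable functions are limits of these with a
common bound. *)
Lemma functional_monotone_class (f : T -> R) : bounded_mfun f -> P f.
Proof.
move=> [mf [M fM]].
have mp : measurable_fun setT f^\+ by exact: measurable_funrpos.
have mn : measurable_fun setT f^\- by exact: measurable_funrneg.
have bp x : 0 <= f^\+ x <= M.
  rewrite funrpos_ge0/= /funrpos ge_max (le_trans (ler_norm _) (fM x)).
  exact: le_trans (fM x).
have bn x : 0 <= f^\- x <= M.
  rewrite funrneg_ge0/= /funrneg ge_max (le_trans (normr_ge0 _) (fM x)) andbT.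
  by rewrite (le_trans (ler_norm _))// normrN.
have Bp : bounded_mfun f^\+.
  by split=> //; exists M => x; rewrite ger0_norm//; case/andP: (bp x).
have Bn : bounded_mfun f^\-.
  by split=> //; exists M => x; rewrite ger0_norm//; case/andP: (bn x).
apply: (P_eq _ (Plin (-1) Bn Bp (P_nonneg mn bn) (P_nonneg mp bp))).
by move=> x; rewrite mulN1r addrC; rewrite -[in RHS](funrposBneg f).
Qed.

End functional_monotone_class.

(** * Real-valued integrals and tensor products *)

Section real_integrals.
Context d (T : measurableType d) (R : realType).
Variable m : {measure set T -> \bar R}.
Local Notation integrable f := (m.-integrable setT (EFin \o f)).

Lemma integrable_dominated (f g : T -> R) : measurable_fun setT f ->
  integrable g -> (forall x, `|f x| <= g x) -> integrable f.
Proof.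
move=> mf ig fg; apply: le_integrable ig => //; first exact/measurable_EFinP.
by move=> x _ /=; rewrite lee_fin (le_trans (fg x))// ler_norm.
Qed.

Lemma integrable_measurable (f : T -> R) : integrable f -> measurable_fun setT f.
Proof. by move=> /measurable_int/measurable_EFinP. Qed.

Lemma integrable_scale (a : R) (f : T -> R) : integrable f ->
  integrable (fun x => a * f x).
Proof. by move=> fi; have /= h := integrableZl measurableT a fi; exact: h. Qed.

Lemma integrable_normr (f : T -> R) : integrable f -> integrable (fun x => `|f x|).
Proof. exact: integrable_norm. Qed.

Lemma integrable_lin (a : R) (f g : T -> R) : integrable f -> integrable g ->
  integrable (fun x => a * f x + g x).
Proof.
move=> fi gi; have /= h := integrableD measurableT (integrable_scale a fi) gi.
exact: h.
Qed.

Lemma Rintegral_lin_on (D : set T) (a : R) (f g : T -> R) : measurable D ->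
  m.-integrable D (EFin \o f) -> m.-integrable D (EFin \o g) ->
  \int[m]_(x in D) (a * f x + g x) =
  a * \int[m]_(x in D) f x + \int[m]_(x in D) g x.
Proof.
move=> mD fi gi; rewrite RintegralD// ?RintegralZl//.
by have /= h := integrableZl mD a fi; exact: h.
Qed.

Lemma Rintegral_lin (a : R) (f g : T -> R) : integrable f -> integrable g ->
  \int[m]_x (a * f x + g x) = a * \int[m]_x f x + \int[m]_x g x.
Proof. exact: Rintegral_lin_on. Qed.

Lemma norm_Rintegral_le (f g : T -> R) : measurable_fun setT f ->
  integrable g -> (forall x, `|f x| <= g x) -> `|\int[m]_x f x| <= \int[m]_x g x.
Proof.
move=> mf ig fg; have fi := integrable_dominated mf ig fg.
rewrite (le_trans (le_normr_Rintegral measurableT fi))//.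
by apply: le_Rintegral => //; exact: integrable_norm.
Qed.

Lemma Rintegral_dominated_cvg (D : set T) (f_ : nat -> T -> R) (f g : T -> R) :
  measurable D -> (forall n, measurable_fun D (f_ n)) ->
  (forall x, D x -> f_ ^~ x @ \oo --> f x) -> m.-integrable D (EFin \o g) ->
  (forall n x, D x -> `|f_ n x| <= g x) ->
  (fun n => \int[m]_(x in D) f_ n x) @ \oo --> \int[m]_(x in D) f x.
Proof.
move=> mD mf_ f_f ig f_g.
have mf : measurable_fun D f by exact: (measurable_fun_cvg (h := f_)).
have [] // := @dominated_convergence _ _ _ m D mD
  (fun n => EFin \o f_ n) (EFin \o f) (EFin \o g).
- by move=> n; exact/measurable_EFinP.
- exact/measurable_EFinP.
- apply: aeW => x Dx; apply: cvg_EFin; first exact: nearW.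
  exact: f_f.
- by apply: aeW => x n Dx; rewrite /= lee_fin f_g.
move=> fi _ h.
have : fine \o (fun n => \int[m]_(x in D) (EFin \o f_ n) x)%E @ \oo -->
    fine (\int[m]_(x in D) (EFin \o f) x)%E.
  apply: fine_cvg; rewrite fineK; first exact: h.
  exact: integrable_fin_num.
exact.
Qed.

Lemma ae_imply (P Q : T -> Prop) : (forall x, P x -> Q x) ->
  {ae m, forall x, P x} -> {ae m, forall x, Q x}.
Proof. by move=> PQ; exact: filterS. Qed.

Lemma ae_imply2 (P Q S : T -> Prop) : (forall x, P x -> Q x -> S x) ->
  {ae m, forall x, P x} -> {ae m, forall x, Q x} -> {ae m, forall x, S x}.
Proof. by move=> PQS; exact: filterS2. Qed.

Lemma Rintegral_ae_eq (f g : T -> R) : measurable_fun setT f ->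
  measurable_fun setT g -> {ae m, forall x, f x = g x} ->
  \int[m]_x f x = \int[m]_x g x.
Proof.
move=> mf mg fg; congr fine; apply: ae_eq_integral => //.
- exact/measurable_EFinP.
- exact/measurable_EFinP.
- by apply: ae_imply fg => x /= -> _.
Qed.

Lemma Rintegral_norm_eq0 (f : T -> R) : integrable f ->
  \int[m]_x `|f x| = 0 -> {ae m, forall x, f x = 0}.
Proof.
move=> fi f0.
have /integrableP[mf _] := fi.
have E : (\int[m]_x `|(EFin \o f) x| = 0)%E.
  rewrite -[LHS]fineK; last first.
    exact: (integrable_fin_num measurableT (integrable_abse fi)).
  by rewrite (f0 : fine _ = 0).
have := (ae_eq_integral_abs m measurableT mf).1 E.
by apply: filterS => x /= /(_ Logic.I) [].
Qed.

End real_integrals.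

Section tensor.
Context d1 d2 (T1 : measurableType d1) (T2 : measurableType d2) (R : realType).
Variables (m1 : {sigma_finite_measure set T1 -> \bar R}).
Variables (m2 : {sigma_finite_measure set T2 -> \bar R}).

Let measurable_tensor (f : T1 -> R) (g : T2 -> R) : measurable_fun setT f ->
  measurable_fun setT g -> measurable_fun setT (fun p : T1 * T2 => f p.1 * g p.2).
Proof.
by move=> mf mg; apply: measurable_funM; apply: measurableT_comp.
Qed.

Lemma integrable_tensor (f : T1 -> R) (g : T2 -> R) :
  m1.-integrable setT (EFin \o f) -> m2.-integrable setT (EFin \o g) ->
  (m1 \x m2)%E.-integrable setT (EFin \o (fun p => f p.1 * g p.2)).
Proof.
move=> fi gi; apply/integrable12ltyP.
  by apply/measurable_EFinP; exact: measurable_tensor (integrable_measurable fi) (integrable_measurable gi).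
have /integrableP[mf fy] := fi; have /integrableP[mg gy] := gi.
rewrite (eq_integral (fun x => `|(EFin \o f) x| * \int[m2]_y `|(EFin \o g) y|)%E).
  rewrite ge0_integralZr//; [|exact: measurableT_comp|exact: integral_ge0].
  rewrite lte_mul_pinfty//; first exact: integral_ge0.
  by rewrite ge0_fin_numE//; exact: integral_ge0.
move=> x _; rewrite -ge0_integralZl//; last exact: measurableT_comp.
by apply: eq_integral => y _ /=; rewrite -EFinM normrM.
Qed.

Lemma Rintegral_tensor (f : T1 -> R) (g : T2 -> R) :
  m1.-integrable setT (EFin \o f) -> m2.-integrable setT (EFin \o g) ->
  \int[(m1 \x m2)%E]_p (f p.1 * g p.2) = \int[m1]_x f x * \int[m2]_y g y.
Proof.
move=> fi gi; have fgi := integrable_tensor fi gi.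
rewrite /Rintegral -(integral12_prod_meas1 fgi) /fubini_F /=.
rewrite (eq_integral (fun x => (f x)%:E * (\int[m2]_y g y)%:E)%E).
  by rewrite integralZr//= fineM//=; exact: (integrable_fin_num measurableT fi).
move=> x _; rewrite [in RHS]/Rintegral fineK ?integrable_fin_num//.
by rewrite -integralZl//; apply: eq_integral.
Qed.

End tensor.

(** * Pairings that depend measurably on a parameter *)

Section parametrized_integrals.
Context d0 (S : measurableType d0) (R : realType) (D : set S).

(** The family [a] of densities depends measurably on the parameter when tested
against bounded functions.  Weak continuity in L^1 gives no more than this: the
representatives of the densities at different times are unrelated. *)
Definition measurable_pairings d (T : measurableType d)
    (m : {measure set T -> \bar R}) (a : S -> T -> R) :=
  forall f : T -> R, bounded_mfun f -> measurable_fun D (fun s => \int[m]_x (f x * a s x)).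

Lemma integrable_bounded_mul d (T : measurableType d)
    (m : {measure set T -> \bar R}) (f g : T -> R) :
  bounded_mfun f -> m.-integrable setT (EFin \o g) ->
  m.-integrable setT (EFin \o (fun x => f x * g x)).
Proof.
move=> [mf [M fM]] gi.
apply: (@integrable_dominated _ _ _ _ _ (fun x => M * `|g x|)).
- by apply: measurable_funM => //; exact: integrable_measurable gi.
- exact: (integrable_scale M (integrable_normr gi)).
- by move=> x; rewrite normrM ler_wpM2r.
Qed.

(** For an indicator of a rectangle the pairing with a tensor product is a product
of two measurable pairings; rectangles form a pi-system that generates the
product sigma-algebra. *)
Lemma measurable_pairings_tensor d1 d2 (T1 : measurableType d1)
    (T2 : measurableType d2) (m1 : {sigma_finite_measure set T1 -> \bar R})
    (m2 : {sigma_finite_measure set T2 -> \bar R})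
    (a : S -> T1 -> R) (b : S -> T2 -> R) :
  (forall s, D s -> m1.-integrable setT (EFin \o a s)) ->
  (forall s, D s -> m2.-integrable setT (EFin \o b s)) ->
  measurable_pairings m1 a -> measurable_pairings m2 b ->
  measurable_pairings (m1 \x m2)%E (fun s p => a s p.1 * b s p.2).
Proof.
move=> ai bi ma mb.
have abi s : D s ->
    (m1 \x m2)%E.-integrable setT (EFin \o (fun p => a s p.1 * b s p.2)).
  by move=> Ds; apply: integrable_tensor; [exact: ai|exact: bi].
apply: (functional_monotone_class (measurable_prod_measurableType _ _)).
- move=> _ _ [A1 mA1 [B1 mB1 <-]] [A2 mA2 [B2 mB2 <-]].
  rewrite -setXI; exists (A1 `&` A2); first exact: measurableI.
  by exists (B1 `&` B2) => //; exact: measurableI.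
- move=> _ [A mA [B mB <-]].
  apply: (@eq_measurable_fun _ _ _ _ _ (fun s =>
    (\int[m1]_x (\1_A x * a s x)) * (\int[m2]_x (\1_B x * b s x)))); last first.
    by apply: measurable_funM; [apply: ma|apply: mb]; exact: bounded_indic.
  move=> s /set_mem Ds; rewrite -Rintegral_tensor//=; last 2 first.
  - by apply: integrable_bounded_mul; [exact: bounded_indic|exact: ai].
  - by apply: integrable_bounded_mul; [exact: bounded_indic|exact: bi].
  apply: eq_Rintegral => -[x y] _ /=.
  rewrite mulrACA; congr (_ * _); rewrite !indicE -natrM mulnb; congr (_ %:R).
  by rewrite in_setX.
- apply: (@eq_measurable_fun _ _ _ _ _ (fun s =>
    (\int[m1]_x (cst 1 x * a s x)) * (\int[m2]_x (cst 1 x * b s x)))); last first.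
    by apply: measurable_funM; [apply: ma|apply: mb]; split => //; exists 1 => x; rewrite normr1.
  move=> s /set_mem Ds; rewrite -Rintegral_tensor//=.
  + by apply: eq_Rintegral => -[x y] _ /=; rewrite !mul1r.
  + by under [X in EFin \o X]eq_fun do rewrite mul1r; exact: ai.
  + by under [X in EFin \o X]eq_fun do rewrite mul1r; exact: bi.
- move=> r f g bf bg mf mg.
  apply: (@eq_measurable_fun _ _ _ _ _ (fun s =>
    r * (\int[(m1 \x m2)%E]_p (f p * (a s p.1 * b s p.2)))
    + \int[(m1 \x m2)%E]_p (g p * (a s p.1 * b s p.2)))); last first.
    by apply: measurable_funD => //; exact: measurable_funM.
  move=> s /set_mem Ds; rewrite -Rintegral_lin.
  + by apply: eq_Rintegral => p _; rewrite mulrDl mulrA.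
  + by apply: integrable_bounded_mul => //; exact: abi.
  + by apply: integrable_bounded_mul => //; exact: abi.
- move=> f_ f M mf_ f_M f_f mf_s.
  apply: (measurable_fun_cvg (h := fun n s =>
    \int[(m1 \x m2)%E]_p (f_ n p * (a s p.1 * b s p.2)))) => //.
  move=> s Ds.
  apply: (Rintegral_dominated_cvg (g := fun p => M * `|a s p.1 * b s p.2|)) => //.
  + move=> n; apply: measurable_funM => //.
    exact: integrable_measurable (abi s Ds).
  + by move=> p _; apply: cvgMl; exact: f_f.
  + exact: (integrable_scale M (integrable_normr (abi s Ds))).
  + by move=> n p _; rewrite normrM ler_wpM2r.
Qed.

End parametrized_integrals.

(** * The square root weight, moments and triple integrals *)

Section weight.
Variable R : realType.
Implicit Types x y z : R.

Definition weight (x : R) : R := Num.sqrt (1 + `|x|).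

Lemma weight_sqr x : weight x * weight x = 1 + `|x|.
Proof. by rewrite -expr2 sqr_sqrtr. Qed.

Lemma weight_ge1 x : 1 <= weight x.
Proof. by rewrite -[X in X <= _]sqrtr1 ler_sqrt// lerDl. Qed.

Lemma weight_ge0 x : 0 <= weight x.
Proof. exact: sqrtr_ge0. Qed.

Lemma weight_gt0 x : 0 < weight x.
Proof. by rewrite (lt_le_trans ltr01)// weight_ge1. Qed.

Lemma weight_homo x y : `|x| <= `|y| -> weight x <= weight y.
Proof. by move=> xy; rewrite ler_sqrt// lerD2l. Qed.

Lemma weight_le x : weight x <= 1 + `|x|.
Proof. by rewrite -weight_sqr ler_peMr ?weight_ge0 ?weight_ge1. Qed.

(** This is 1 + |y| + |z| <= (1 + |y|) (1 + |z|): it splits the weight at [y + z] into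
factors that the moments in [y] and in [z] absorb separately. *)
Lemma weightD_le_mul y z : weight (y + z) <= weight y * weight z.
Proof.
rewrite -sqrtrM// ler_sqrt ?mulr_ge0//.
have := ler_normD y z; have := normr_ge0 y; have := normr_ge0 z.
by move: `|y| `|z| `|y + z| => a b c; nra.
Qed.

Lemma weightD_le_add y z : weight (y + z) <= weight y + weight z.
Proof.
have a0 := weight_ge0 y; have b0 := weight_ge0 z.
rewrite -(@ler_pXn2r _ 2)// ?nnegrE ?addr_ge0 ?weight_ge0//.
rewrite sqr_sqrtr// sqrrD /weight !sqr_sqrtr// -/(weight y) -/(weight z).
have := ler_normD y z; have : 0 <= weight y * weight z by rewrite mulr_ge0.
by move: (weight y * weight z) => t; lra.
Qed.

Lemma measurable_sgr : measurable_fun setT (@Num.sg R).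
Proof.
apply: nondecreasing_measurable => // a b ab.
by case: (sgrP a); case: (sgrP b) => // b0 a0; rewrite ?lerN10 ?ler01 ?ler0N1//; lra.
Qed.

Lemma measurable_weight : measurable_fun setT weight.
Proof.
have ms : measurable_fun setT (@Num.sqrt R).
  by apply: continuous_measurable_fun; exact: sqrt_continuous.
apply: (measurableT_comp ms).
by apply: measurable_funD => //; exact: measurableT_comp.
Qed.

(** Bounded approximation of the weight that stays increasing and keeps the
subadditivity [capped_weightD], the two properties on which the contraction
estimate relies. *)
Definition capped_weight (n : nat) x : R := Num.min (weight x) n%:R.

Lemma capped_weight_ge0 n x : 0 <= capped_weight n x.
Proof. by rewrite le_min weight_ge0 ler0n. Qed.

Lemma capped_weight_le n x : capped_weight n x <= weight x.
Proof. by rewrite ge_min lexx. Qed.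

Lemma capped_weight_le_nat n x : capped_weight n x <= n%:R.
Proof. by rewrite ge_min lexx orbT. Qed.

Lemma capped_weight_homo n x y : `|x| <= `|y| ->
  capped_weight n x <= capped_weight n y.
Proof. by move=> xy; rewrite le_min2// weight_homo. Qed.

Lemma capped_weightD n y z :
  capped_weight n (y + z) <= capped_weight n y + weight z.
Proof.
have h := weightD_le_add y z; have z0 := weight_ge0 z.
rewrite [capped_weight n y]/Order.min; case: ifP => _.
  by rewrite (le_trans (capped_weight_le _ _)).
by rewrite (le_trans (capped_weight_le_nat _ _))// lerDl.
Qed.

Lemma measurable_capped_weight n : measurable_fun setT (capped_weight n).
Proof. by apply: measurable_minr => //; exact: measurable_weight. Qed.

Lemma cvg_capped_weight x : (fun n => capped_weight n x) @ \oo --> weight x.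
Proof.
apply: cvg_near_cst; near=> n; apply/min_idPl.
by near: n; exact: nbhs_infty_ger.
Unshelve. all: by end_near.
Qed.

End weight.

Section moments.
Variable R : realType.
Local Notation mu := (@lebesgue_measure R).
Local Notation integrable f := (mu.-integrable setT (EFin \o f)).

Definition has_moment (f : R -> R) :=
  measurable_fun setT f /\ integrable (fun x => (1 + `|x|) * `|f x|).

Definition moment (f : R -> R) := \int[mu]_x ((1 + `|x|) * `|f x|).

(** The norm in which uniqueness is proved.  With this weight, each factor of the
kernel is either absorbed by the norm itself or completes another weight into a
first moment of the solutions. *)
Definition half_moment (f : R -> R) := \int[mu]_x (weight x * `|f x|).

Lemma measurable_weight_norm (f : R -> R) : measurable_fun setT f ->
  measurable_fun setT (fun x => weight x * `|f x|).
Proof.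
move=> mf; apply: measurable_funM; first exact: measurable_weight.
exact: measurableT_comp.
Qed.

Lemma has_moment_integrable_half (f : R -> R) : has_moment f ->
  integrable (fun x => weight x * `|f x|).
Proof.
move=> [mf fi]; apply: integrable_dominated fi _; first exact: measurable_weight_norm.
by move=> x; rewrite normrM normr_id ler_wpM2r// ger0_norm ?weight_ge0// weight_le.
Qed.

Lemma has_moment_integrable (f : R -> R) : has_moment f -> integrable f.
Proof.
move=> [mf fi]; apply: integrable_dominated fi _; first exact: mf.
by move=> x; rewrite ler_peMl// lerDl.
Qed.

Lemma has_moment_weight (f : R -> R) : has_moment f ->
  integrable (fun x => weight x * f x).
Proof.
move=> hf; have [mf _] := hf.
apply: (integrable_dominated _ (has_moment_integrable_half hf)).
  by apply: measurable_funM => //; exact: measurable_weight.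
by move=> x; rewrite normrM (ger0_norm (weight_ge0 x)).
Qed.

Lemma has_momentB (f g : R -> R) : has_moment f -> has_moment g ->
  has_moment (fun x => f x - g x).
Proof.
move=> [mf fi] [mg gi]; split; first exact: measurable_funB.
apply: (integrable_dominated _ (integrable_lin 1 fi gi)).
  apply: measurable_funM; first by apply: measurable_funD => //; exact: measurableT_comp.
  by apply: measurableT_comp => //; exact: measurable_funB.
move=> x; rewrite mul1r -mulrDr normrM normr_id ger0_norm ?addr_ge0//.
by rewrite ler_wpM2l ?addr_ge0// ler_normB.
Qed.

Lemma moment_ge0 (f : R -> R) : 0 <= moment f.
Proof. by apply: Rintegral_ge0 => x _; rewrite mulr_ge0// addr_ge0. Qed.

Lemma half_moment_ge0 (f : R -> R) : 0 <= half_moment f.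
Proof. by apply: Rintegral_ge0 => x _; rewrite mulr_ge0// weight_ge0. Qed.

Lemma half_moment_le (f : R -> R) : has_moment f -> half_moment f <= moment f.
Proof.
move=> hf; have [mf fi] := hf; apply: le_Rintegral => //.
  exact: has_moment_integrable_half.
by move=> x _; rewrite ler_wpM2r// weight_le.
Qed.

Lemma momentB_le (f g : R -> R) : has_moment f -> has_moment g ->
  moment (fun x => f x - g x) <= moment f + moment g.
Proof.
move=> hf hg; have [mf fi] := hf; have [mg gi] := hg.
rewrite /moment -RintegralD//; apply: le_Rintegral => //.
- by have [] := has_momentB hf hg.
- by have := integrable_lin 1 fi gi; under [X in EFin \o X]eq_fun do rewrite mul1r.
- by move=> x _; rewrite -mulrDr ler_wpM2l ?addr_ge0// ler_normB.
Qed.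

End moments.

Section sigma_finite_product.
Context d1 d2 (T1 : measurableType d1) (T2 : measurableType d2) (R : realType).
Variables (m1 : {sigma_finite_measure set T1 -> \bar R})
  (m2 : {sigma_finite_measure set T2 -> \bar R}).

(** The product measure under a name of its own, which carries the sigma-finite
structure needed to take a product once more. *)
Definition prodm : set (T1 * T2) -> \bar R := (m1 \x m2)%E.

HB.instance Definition _ := Measure.on prodm.

Let prodm_sigma_finite : sigma_finite setT prodm.
Proof.
have /sigma_finiteP[F [FT ndF Ffin]] := sigma_finiteT m1.
have /sigma_finiteP[G [GT ndG Gfin]] := sigma_finiteT m2.
exists (fun n => F n `*` G n).
  apply/seteqP; split => // -[x y] _.
  have [i _ Fx] : (\bigcup_i F i) x by rewrite -FT.
  have [j _ Gy] : (\bigcup_i G i) y by rewrite -GT.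
  exists (maxn i j) => //; split => /=.
    by have /subsetPset := ndF _ _ (leq_maxl i j); exact.
  by have /subsetPset := ndG _ _ (leq_maxr i j); exact.
move=> n; have [mF F_lty] := Ffin n; have [mG G_lty] := Gfin n.
split; first exact: measurableX.
by rewrite /prodm product_measure1E// lte_mul_pinfty// ge0_fin_numE.
Qed.

HB.instance Definition _ :=
  Measure_isSigmaFinite.Build _ _ _ prodm prodm_sigma_finite.

End sigma_finite_product.

(** Bounds on a triple integral by three simple ones, for integrands dominated
by a tensor product. *)
Section triple.
Context d1 d2 d3 (T1 : measurableType d1) (T2 : measurableType d2)
  (T3 : measurableType d3) (R : realType).
Variables (m1 : {sigma_finite_measure set T1 -> \bar R})
  (m2 : {sigma_finite_measure set T2 -> \bar R})
  (m3 : {sigma_finite_measure set T3 -> \bar R}).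
Local Notation m123 := (prodm m1 m2 \x m3)%E.
Variables (F : T1 * T2 * T3 -> R) (a : T1 -> R) (b : T2 -> R) (c : T3 -> R).
Hypotheses (ai : m1.-integrable setT (EFin \o a))
  (bi : m2.-integrable setT (EFin \o b)) (ci : m3.-integrable setT (EFin \o c)).

Let abi : (prodm m1 m2).-integrable setT (EFin \o (fun q => a q.1 * b q.2)).
Proof. exact: integrable_tensor ai bi. Qed.

Let abci := integrable_tensor abi ci.

Let abcE : \int[m123]_p (a p.1.1 * b p.1.2 * c p.2) =
  \int[m1]_x a x * \int[m2]_x b x * \int[m3]_x c x.
Proof. by rewrite (Rintegral_tensor abi ci) (Rintegral_tensor ai bi). Qed.

Lemma integrable_triple : measurable_fun setT F ->
  (forall p, `|F p| <= a p.1.1 * b p.1.2 * c p.2) ->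
  m123.-integrable setT (EFin \o F).
Proof. by move=> mF Fle; exact: integrable_dominated mF abci Fle. Qed.

Lemma norm_Rintegral_triple : measurable_fun setT F ->
  (forall p, `|F p| <= a p.1.1 * b p.1.2 * c p.2) ->
  `|\int[m123]_p F p| <= \int[m1]_x a x * \int[m2]_x b x * \int[m3]_x c x.
Proof. by move=> mF Fle; rewrite -abcE; exact: norm_Rintegral_le mF abci Fle. Qed.

Lemma Rintegral_triple_le : m123.-integrable setT (EFin \o F) ->
  (forall p, F p <= a p.1.1 * b p.1.2 * c p.2) ->
  \int[m123]_p F p <= \int[m1]_x a x * \int[m2]_x b x * \int[m3]_x c x.
Proof. by move=> Fi Fle; rewrite -abcE; apply: le_Rintegral. Qed.

End triple.

(** * The exchange form *)

Section exchange.
Variable R : realType.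
Local Notation X := (measurableTypeR R).
Local Notation mu := (@lebesgue_measure R).
Local Notation mu3 := (prodm mu mu \x mu)%E.
Local Notation integrable f := (mu.-integrable setT (EFin \o f)).

Variables (K : X * X * X -> R) (c : R -> R).
Hypotheses (mK : measurable_fun setT K) (K_ge0 : forall p, 0 <= K p)
  (K_supp : forall p, K p != 0 -> [/\ 0 < p.1.1, 0 < p.1.2 & 0 < p.2 < p.1.1])
  (K_le : forall p, K p <= weight p.1.1 * weight p.1.2 * c p.2)
  (hc : has_moment c) (c_ge0 : forall z, 0 <= c z).

(** The integrand of the weak formulation, as a trilinear expression in the test
function and in two densities; keeping the densities distinct allows one to
polarize the quadratic term. *)
Definition exchange_integrand (w u v : R -> R) (p : X * X * X) : R :=
  wtilde w p.1.1 p.1.2 p.2 * K p * u p.1.1 * v p.1.2.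

Definition exchange (w u v : R -> R) : R :=
  \int[mu3]_p exchange_integrand w u v p.

Let mp1 : measurable_fun setT (fun p : X * X * X => p.1.1).
Proof. by apply: (measurableT_comp measurable_fst); exact: measurable_fst. Qed.

Let mp2 : measurable_fun setT (fun p : X * X * X => p.1.2).
Proof. by apply: (measurableT_comp measurable_snd); exact: measurable_fst. Qed.

Let mp3 : measurable_fun setT (fun p : X * X * X => p.2).
Proof. exact: measurable_snd. Qed.

Lemma measurable_wtilde (w : R -> R) : measurable_fun setT w ->
  measurable_fun setT (fun p : X * X * X => wtilde w p.1.1 p.1.2 p.2).
Proof.
move=> mw; apply: measurable_funB; [apply: measurable_funB;
  [apply: measurable_funD|]|]; apply: (measurableT_comp mw) => //.
  exact: measurable_funD.
exact: measurable_funB.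
Qed.

Lemma measurable_exchange_integrand (w u v : R -> R) : measurable_fun setT w ->
  measurable_fun setT u -> measurable_fun setT v ->
  measurable_fun setT (exchange_integrand w u v).
Proof.
move=> mw mu_ mv; apply: measurable_funM; last exact: (measurableT_comp mv).
apply: measurable_funM; last exact: (measurableT_comp mu_).
by apply: measurable_funM => //; exact: measurable_wtilde.
Qed.

Lemma norm_wtilde_le (w : R -> R) (M : R) : (forall x, `|w x| <= M) ->
  forall x y z, `|wtilde w x y z| <= 4 * M.
Proof.
move=> wM x y z; rewrite /wtilde.
have := wM (y + z); have := wM (x - z); have := wM x; have := wM y.
by rewrite !ler_norml => /andP[? ?] /andP[? ?] /andP[? ?] /andP[? ?]; lra.
Qed.

Lemma norm_exchange_integrand_le (w u v : R -> R) (M : R) :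
  (forall x, `|w x| <= M) -> forall p,
  `|exchange_integrand w u v p| <=
    (4 * M * (weight p.1.1 * `|u p.1.1|)) * (weight p.1.2 * `|v p.1.2|) * c p.2.
Proof.
move=> wM p; rewrite /exchange_integrand 3!normrM (ger0_norm (K_ge0 p)).
have M0 : 0 <= M by rewrite (le_trans _ (wM 0)).
rewrite [leRHS](_ : _ = (4 * M) * (weight p.1.1 * weight p.1.2 * c p.2)
  * `|u p.1.1| * `|v p.1.2|); last by ring.
rewrite ler_wpM2r// ler_wpM2r// ler_pM//.
exact: norm_wtilde_le.
Qed.

Lemma integrable_exchange (w u v : R -> R) : bounded_mfun w ->
  has_moment u -> has_moment v ->
  mu3.-integrable setT (EFin \o exchange_integrand w u v).
Proof.
move=> [mw [M wM]] hu hv; have [mu_ _] := hu; have [mv _] := hv.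
have hu' := integrable_scale (4 * M) (has_moment_integrable_half hu).
have hv' := has_moment_integrable_half hv.
have hc' := has_moment_integrable hc.
apply: (integrable_triple hu' hv' hc' _ (norm_exchange_integrand_le u v wM)).
exact: measurable_exchange_integrand.
Qed.

Definition rate := \int[mu]_z c z.

Lemma rate_ge0 : 0 <= rate.
Proof. exact: Rintegral_ge0. Qed.

Lemma norm_exchange_le (w u v : R -> R) (M : R) : measurable_fun setT w ->
  (forall x, `|w x| <= M) -> has_moment u -> has_moment v ->
  `|exchange w u v| <= 4 * M * half_moment u * half_moment v * rate.
Proof.
move=> mw wM hu hv; have [mu_ _] := hu; have [mv _] := hv.
have hu' := integrable_scale (4 * M) (has_moment_integrable_half hu).
have := norm_Rintegral_triple hu' (has_moment_integrable_half hv)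
  (has_moment_integrable hc) _ (norm_exchange_integrand_le u v wM).
rewrite RintegralZl//; last exact: has_moment_integrable_half.
by apply; exact: measurable_exchange_integrand.
Qed.

Lemma exchange_linl (w u u' v : R -> R) : bounded_mfun w ->
  has_moment u -> has_moment u' -> has_moment v ->
  exchange w (fun x => u x - u' x) v = exchange w u v - exchange w u' v.
Proof.
move=> bw hu hu' hv; rewrite /exchange -RintegralB//; last 2 first.
- exact: integrable_exchange.
- exact: integrable_exchange.
by apply: eq_Rintegral => p _; rewrite /exchange_integrand; ring.
Qed.

Lemma exchange_linr (w u v v' : R -> R) : bounded_mfun w ->
  has_moment u -> has_moment v -> has_moment v' ->
  exchange w u (fun x => v x - v' x) = exchange w u v - exchange w u v'.
Proof.
move=> bw hu hv hv'; rewrite /exchange -RintegralB//; last 2 first.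
- exact: integrable_exchange.
- exact: integrable_exchange.
by apply: eq_Rintegral => p _; rewrite /exchange_integrand; ring.
Qed.

Lemma exchange_linw (a : R) (w w' u v : R -> R) : bounded_mfun w ->
  bounded_mfun w' -> has_moment u -> has_moment v ->
  exchange (fun x => a * w x + w' x) u v = a * exchange w u v + exchange w' u v.
Proof.
move=> bw bw' hu hv; rewrite /exchange -Rintegral_lin; last 2 first.
- exact: integrable_exchange.
- exact: integrable_exchange.
by apply: eq_Rintegral => p _; rewrite /exchange_integrand /wtilde; ring.
Qed.

(** Continuity in the test function along bounded pointwise limits; the
domination by the weights does not involve the limit. *)
Lemma cvg_exchange (w_ : nat -> R -> R) (w u v : R -> R) (M : R) :
  (forall n, measurable_fun setT (w_ n)) -> (forall n x, `|w_ n x| <= M) ->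
  (forall x, w_ ^~ x @ \oo --> w x) -> has_moment u -> has_moment v ->
  (fun n => exchange (w_ n) u v) @ \oo --> exchange w u v.
Proof.
move=> mw wM ww hu hv; have [mu_ _] := hu; have [mv _] := hv.
apply: (@Rintegral_dominated_cvg _ _ _ _ _ _ _ (fun p : X * X * X =>
  (4 * M * (weight p.1.1 * `|u p.1.1|)) * (weight p.1.2 * `|v p.1.2|) * c p.2)) => //.
- by move=> n; exact: measurable_exchange_integrand.
- move=> p _; rewrite /exchange_integrand; do 3 apply: cvgMl.
  by rewrite /wtilde; apply: cvgB => //; apply: cvgB => //; apply: cvgD.
- have hu' := integrable_scale (4 * M) (has_moment_integrable_half hu).
  have hv' := has_moment_integrable_half hv.
  have hc' := has_moment_integrable hc.
  apply: (integrable_triple hu' hv' hc').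
    apply: measurable_funM; last first.
      exact: (measurableT_comp (integrable_measurable hc')).
    apply: measurable_funM.
      exact: (measurableT_comp (integrable_measurable hu')).
    exact: (measurableT_comp (integrable_measurable hv')).
  move=> p; have M0 : 0 <= M by rewrite (le_trans _ (wM 0%N 0)).
  by rewrite ger0_norm// !mulr_ge0// weight_ge0.
- by move=> n p _; exact: norm_exchange_integrand_le.
Qed.

Section measurable_in_time.
Context d (S : measurableType d) (D : set S) (u : S -> R -> R).
Hypotheses (mD : measurable D) (hu : forall s, D s -> has_moment (u s))
  (pu : measurable_pairings D mu u).

(** The weight is unbounded, so it is reached through its capped versions. *)
Let pairings_weight : measurable_pairings D mu (fun s x => weight x * u s x).
Proof.
move=> f [mf [M fM]].
have mt n : measurable_fun setT (capped_weight n : X -> R).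
  exact: measurable_capped_weight.
apply: (measurable_fun_cvg (h := fun n s =>
  \int[mu]_x ((f x * capped_weight n x) * u s x))) => //.
- move=> n; apply: pu; split; first exact: measurable_funM.
  exists (M * n%:R) => x; rewrite normrM ler_pM// ger0_norm//.
    exact: capped_weight_le_nat.
  exact: capped_weight_ge0.
- move=> s Ds; have hus := hu Ds; have [mus _] := hus.
  apply: (@Rintegral_dominated_cvg _ X R mu setT
    (fun n x => f x * capped_weight n x * u s x)
    (fun x => f x * (weight x * u s x))
    (fun x => M * (weight x * `|u s x|))) => //.
  + by move=> n; apply: measurable_funM => //; exact: measurable_funM.
  + move=> x _; rewrite [X in _ --> X]mulrA; apply: cvgMl; apply: cvgMr.
    exact: cvg_capped_weight.
  + exact: (integrable_scale M (has_moment_integrable_half hus)).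
  + move=> n x _; rewrite !normrM -mulrA ler_pM// ?mulr_ge0//.
    by rewrite ler_wpM2r// ger0_norm ?capped_weight_ge0// capped_weight_le.
Qed.

(** After division by the weights and by [c] the kernel is bounded, and the
densities [weight x * u s x] are integrable: the form becomes a pairing of a
bounded function with a triple tensor product. *)
Lemma measurable_exchange (w : R -> R) : bounded_mfun w ->
  measurable_fun D (fun s => exchange w (u s) (u s)).
Proof.
move=> [mw [M wM]].
have hw s : D s -> integrable (fun x => weight x * u s x).
  by move=> Ds; exact: has_moment_weight (hu Ds).
have p2 : measurable_pairings D (prodm mu mu)
    (fun s q => (weight q.1 * u s q.1) * (weight q.2 * u s q.2)).
  have := measurable_pairings_tensor hw hw pairings_weight pairings_weight.
  by apply.
have hw2 s : D s -> (prodm mu mu).-integrable setT (EFin \o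
    (fun q => (weight q.1 * u s q.1) * (weight q.2 * u s q.2))).
  by move=> Ds; exact: (integrable_tensor (hw s Ds) (hw s Ds)).
have pc : measurable_pairings D mu (fun=> c).
  by move=> f _; exact: measurable_cst.
have hc' := has_moment_integrable hc.
have := measurable_pairings_tensor hw2 (fun s _ => hc') p2 pc.
pose f (p : X * X * X) := wtilde w p.1.1 p.1.2 p.2 *
  (K p / (weight p.1.1 * weight p.1.2 * c p.2)).
have bf : bounded_mfun f.
  split.
    apply: measurable_funM; first exact: measurable_wtilde.
    apply: measurable_funM => //.
    rewrite (_ : (fun p => _) = (fun x : R => x `^ (-1)) \o
        (fun p : X * X * X => weight p.1.1 * weight p.1.2 * c p.2)); last first.
      by apply/funext => p /=; rewrite powR_inv1// !mulr_ge0// weight_ge0.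
    apply: measurableT_comp; first exact: measurable_powR.
    apply: measurable_funM; last first.
      exact: (measurableT_comp (integrable_measurable hc')).
    by apply: measurable_funM; apply: (measurableT_comp (@measurable_weight R)).
  exists (4 * M) => p; rewrite normrM -[leRHS]mulr1 ler_pM//.
    exact: norm_wtilde_le.
  have [->|cp] := eqVneq (c p.2) 0; first by rewrite mulr0 invr0 mulr0 normr0.
  have cp0 : 0 < c p.2 by rewrite lt_def cp c_ge0.
  have ww0 : 0 < weight p.1.1 * weight p.1.2 by rewrite mulr_gt0 ?weight_gt0.
  rewrite ger0_norm ?divr_ge0 ?mulr_ge0 ?weight_ge0//.
  by rewrite ler_pdivrMr ?mul1r ?K_le// mulr_gt0.
move=> /(_ f bf); apply: eq_measurable_fun => s _.
apply: eq_Rintegral => p _; rewrite /f /exchange_integrand /=.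
(* where c vanishes so does K, and the quotient by 0 is harmless *)
have [c0|cp] := eqVneq (c p.2) 0.
  have Kp : K p = 0.
    by apply/eqP; rewrite eq_le K_ge0 andbT (le_trans (K_le p))// c0 mulr0.
  by rewrite c0 Kp !mul0r !mulr0 !mul0r.
have := weight_gt0 (p.1.1 : R); have := weight_gt0 (p.1.2 : R) => w1 w2.
by field; rewrite cp !gt_eqF.
Qed.

End measurable_in_time.

Section signed_test_function.
Variables (n : nat) (e : R -> R).
Hypothesis he : has_moment e.

(** The test function whose pairing with [e] is the capped moment of [`|e|]. *)
Definition signed_weight (x : R) := capped_weight n x * Num.sg (e x).

Lemma norm_signed_weight_le x : `|signed_weight x| <= capped_weight n x.
Proof.
rewrite normrM (ger0_norm (capped_weight_ge0 n x)).
by rewrite ler_piMr ?capped_weight_ge0// normr_sg lern1 leq_b1.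
Qed.

Lemma signed_weight_mul x : signed_weight x * e x = capped_weight n x * `|e x|.
Proof. by rewrite /signed_weight -mulrA -normrEsg. Qed.

Let signed_weight_mul_le x y b : capped_weight n x <= b ->
  signed_weight x * y <= b * `|y| /\ - signed_weight x * y <= b * `|y|.
Proof.
move=> xb; have h : `|signed_weight x * y| <= b * `|y|.
  by rewrite normrM ler_wpM2r// (le_trans (norm_signed_weight_le x)).
split; first exact: le_trans (ler_norm _) h.
by rewrite (le_trans (ler_norm _))// mulNr normrN.
Qed.

(** The terms at [x - z] and at [x] have a nonpositive sum, because the capped
weight increases and the one at [x] carries the sign of [e x].  Hence no factor
[weight x] is left, and the other two terms only involve [y] and [z]. *)
Lemma wtilde_signed_weightl x y z : 0 < y -> 0 < z < x ->
  wtilde signed_weight x y z * e x <= 3 * (weight y * weight z) * `|e x|.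
Proof.
move=> y0 /andP[z0 zx].
have wyz : weight y <= weight y * weight z by rewrite ler_peMr ?weight_ge0 ?weight_ge1.
have [h1 _] := @signed_weight_mul_le (y + z) (e x) (weight y * weight z)
  (le_trans (capped_weight_le _ _) (weightD_le_mul _ _)).
have [|h2 _] := @signed_weight_mul_le (x - z) (e x) (capped_weight n x).
  by apply: capped_weight_homo; rewrite !ger0_norm ?subr_ge0; lra.
have h3 := signed_weight_mul x.
have [_ h4] := @signed_weight_mul_le y (e x) (weight y * weight z)
  (le_trans (capped_weight_le _ _) wyz).
have : 0 <= weight y * weight z * `|e x| by rewrite !mulr_ge0// weight_ge0.
rewrite /wtilde; lra.
Qed.

(** Here the terms at [y + z] and at [y] combine: by subadditivity their sum is
at most [weight z * `|e y|], so no factor [weight y] is left. *)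
Lemma wtilde_signed_weightr x y z : 0 < y -> 0 < z < x ->
  wtilde signed_weight x y z * e y <= 3 * (weight x * weight z) * `|e y|.
Proof.
move=> y0 /andP[z0 zx].
have wxz : weight x <= weight x * weight z by rewrite ler_peMr ?weight_ge0 ?weight_ge1.
have wzx : weight z <= weight x * weight z by rewrite ler_peMl ?weight_ge0 ?weight_ge1.
have [h1 _] := @signed_weight_mul_le (y + z) (e y) (capped_weight n y + weight z)
  (capped_weightD _ _ _).
have [|h2 _] := @signed_weight_mul_le (x - z) (e y) (weight x * weight z).
  apply: (le_trans _ wxz); apply: (le_trans (capped_weight_le _ _)).
  by apply: weight_homo; rewrite !ger0_norm ?subr_ge0; lra.
have h3 := signed_weight_mul y.
have [_ h4] := @signed_weight_mul_le x (e y) (weight x * weight z)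
  (le_trans (capped_weight_le _ _) wxz).
have h5 : weight z * `|e y| <= weight x * weight z * `|e y| by rewrite ler_wpM2r.
rewrite /wtilde; lra.
Qed.

Lemma bounded_signed_weight : bounded_mfun signed_weight.
Proof.
have [me _] := he.
split; last first.
  exists n%:R => x; rewrite (le_trans (norm_signed_weight_le x))//.
  exact: capped_weight_le_nat.
apply: measurable_funM; first exact: measurable_capped_weight.
by apply: measurableT_comp => //; exact: measurable_sgr.
Qed.

Let ci : integrable (fun z => weight z * c z).
Proof. exact: has_moment_weight. Qed.

(** The kernel brings one weight in each variable, so that the bound of
[wtilde_signed_weightl] becomes the half moment of [e] in [x], the first moment
of [v] in [y], and an integral in [z]. *)
Lemma exchange_signed_weightl (v : R -> R) : has_moment v -> (forall x, 0 <= v x) ->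
  exchange signed_weight e v <=
  3 * half_moment e * moment v * \int[mu]_z (weight z * c z).
Proof.
move=> hv v0; have [_ vi] := hv.
have ei := integrable_scale 3 (has_moment_integrable_half he).
have -> : 3 * half_moment e = \int[mu]_x (3 * (weight x * `|e x|)).
  by rewrite RintegralZl//; exact: has_moment_integrable_half.
apply: (Rintegral_triple_le ei vi ci).
  by apply: integrable_exchange => //; exact: bounded_signed_weight.
move=> [[x y] z] /=; rewrite /exchange_integrand /=.
have [->|Kn0] := eqVneq (K (x, y, z)) 0.
  by rewrite mulr0 !mul0r !mulr_ge0 ?weight_ge0// addr_ge0.
have [/= x0 y0 zx] := K_supp Kn0.
rewrite -weight_sqr (ger0_norm (v0 y)).
have h1 := wtilde_signed_weightl y0 zx.
have h2 := K_le (x, y, z); rewrite /= in h2.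
have h3 := ler_wpM2r (v0 y) (ler_wpM2l (K_ge0 (x, y, z)) h1).
rewrite [leLHS](_ : _ = K (x, y, z) * (wtilde signed_weight x y z * e x) * v y); last by ring.
apply: (le_trans h3).
rewrite [leRHS](_ : _ = weight x * weight y * c z *
  (3 * (weight y * weight z) * `|e x|) * v y); last by ring.
by rewrite ler_wpM2r// ler_wpM2r// !mulr_ge0// weight_ge0.
Qed.

Lemma exchange_signed_weightr (v : R -> R) : has_moment v -> (forall x, 0 <= v x) ->
  exchange signed_weight v e <=
  3 * moment v * half_moment e * \int[mu]_z (weight z * c z).
Proof.
move=> hv v0; have [_ vi] := hv.
have ei := has_moment_integrable_half he.
have -> : 3 * moment v = \int[mu]_x (3 * ((1 + `|x|) * `|v x|)) by rewrite RintegralZl.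
apply: (Rintegral_triple_le (integrable_scale 3 vi) ei ci).
  by apply: integrable_exchange => //; exact: bounded_signed_weight.
move=> [[x y] z] /=; rewrite /exchange_integrand /=.
have [->|Kn0] := eqVneq (K (x, y, z)) 0.
  by rewrite mulr0 !mul0r !mulr_ge0 ?weight_ge0// addr_ge0.
have [/= x0 y0 zx] := K_supp Kn0.
rewrite -weight_sqr (ger0_norm (v0 x)).
have h1 := wtilde_signed_weightr y0 zx.
have h2 := K_le (x, y, z); rewrite /= in h2.
have h3 := ler_wpM2r (v0 x) (ler_wpM2l (K_ge0 (x, y, z)) h1).
rewrite [leLHS](_ : _ = K (x, y, z) * (wtilde signed_weight x y z * e y) * v x); last by ring.
apply: (le_trans h3).
rewrite [leRHS](_ : _ = weight x * weight y * c z *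
  (3 * (weight x * weight z) * `|e y|) * v x); last by ring.
by rewrite ler_wpM2r// ler_wpM2r// !mulr_ge0// weight_ge0.
Qed.

End signed_test_function.

End exchange.

(** * Two growth principles for real functions *)

Section real_functions.
Variable R : realType.

(** Subdivide [a, b] into steps shorter than [del] and add up the increments.
This replaces the integration of a differential inequality for a function whose
derivative is not available. *)
Lemma le_increment_of_local (f : R -> R) (a b k : R) : a <= b ->
  (forall eps : R, 0 < eps -> exists2 del : R, 0 < del &
    forall s t, a <= s -> s <= t -> t <= b -> t - s <= del ->
      f t - f s <= (k + eps) * (t - s)) ->
  f b - f a <= k * (b - a).
Proof.
move=> ab H; apply/ler_addgt0Pr => eps eps0.
have ba0 : 0 < b - a + 1 by lra.
have eps'0 : 0 < eps / (b - a + 1) by rewrite divr_gt0.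
have [del del0 Hdel] := H _ eps'0.
pose N := (Num.truncn ((b - a) / del)).+1.
have N0 : 0 < N%:R :> R by rewrite ltr0n.
pose h := (b - a) / N%:R.
have h0 : 0 <= h by rewrite divr_ge0// subr_ge0.
have hdel : h <= del.
  rewrite /h ler_pdivrMr// mulrC -ler_pdivrMr//.
  by apply/ltW/truncnS_gt.
have Nh : N%:R * h = b - a by rewrite /h mulrC divfK// gt_eqF.
have key (k' : nat) : (k' <= N)%N ->
    f (a + k'%:R * h) - f a <= (k + eps / (b - a + 1)) * (k'%:R * h).
  elim: k' => [|k' IH] kN; first by rewrite mul0r addr0 mulr0 subrr.
  have {}IH := IH (ltnW kN).
  have k'N : k'.+1%:R * h <= b - a by rewrite -Nh ler_wpM2r// ler_nat.
  have E : k'.+1%:R * h = k'%:R * h + h by rewrite -natr1 mulrDl mul1r.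
  have k'0 : 0 <= k'%:R * h by rewrite mulr_ge0.
  rewrite E in k'N *; move: (k'%:R * h) k'0 k'N IH => y y0 yb IH.
  have := Hdel (a + y) (a + (y + h)); rewrite [X in X <= del](_ : _ = h); last by ring.
  rewrite [X in _ * X](_ : _ = h); last by ring.
  move=> hs; have {}hs : f (a + (y + h)) - f (a + y) <= (k + eps / (b - a + 1)) * h.
    by apply: hs => //; lra.
  by move: hs IH; move: (k + _) => e; lra.
have := key N (leqnn N); rewrite Nh (_ : a + (b - a) = b); last by ring.
have : eps / (b - a + 1) * (b - a) <= eps.
  by rewrite -mulrA ler_piMr ?(ltW eps0)// ler_pdivrMl// mulr1; lra.
by move: (eps / _) => e; lra.
Qed.

(** On an interval of length at most 1 / (2 (k + 1)) that starts where [g] is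
nonpositive, the hypothesis halves any nonnegative upper bound of [g]; so [g] is
nonpositive there, and [0, T] is covered by finitely many such intervals. *)
Lemma gronwall_zero (g : R -> R) (T k G : R) : 0 <= T -> 0 <= k -> g 0 <= 0 ->
  (forall t, 0 <= t <= T -> g t <= G) ->
  (forall a b M, 0 <= a -> a <= b -> b <= T ->
    (forall t, a <= t <= b -> g t <= M) -> g b <= g a + k * M * (b - a)) ->
  g T <= 0.
Proof.
move=> T0 k0 g0 gG H.
have k1 : 0 < k + 1 by lra.
pose del := (2 * (k + 1))^-1.
have del0 : 0 < del by rewrite invr_gt0 mulr_gt0.
have kdel : k * del <= 2^-1.
  rewrite /del invfM mulrCA ler_piMr// ?invr_ge0// ler_pdivrMr// mul1r; lra.
have G0 : 0 <= `|G| by [].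
have {}gG t : 0 <= t <= T -> g t <= `|G|.
  by move=> /gG h; rewrite (le_trans h)// ler_norm.
have step (j : nat) : forall t, 0 <= t <= T -> t <= j%:R * del -> g t <= 0.
  elim: j => [|j IH] t /andP[t0 tT]; rewrite ?mul0r.
    by move=> t0'; have -> : t = 0 by apply/eqP; rewrite eq_le t0' t0.
  move=> tj.
  have [/IH->//|jt] := leP t (j%:R * del); first by rewrite t0.
  set a := j%:R * del in jt.
  have a0 : 0 <= a by rewrite mulr_ge0// ltW.
  have aT : a <= T by rewrite (le_trans (ltW jt)).
  have ga : g a <= 0 by apply: IH; rewrite ?a0.
  have tjE : j.+1%:R * del = a + del by rewrite -natr1 mulrDl mul1r.
  (* the bound on [a, a + del] is halved at each round *)
  have halve (i : nat) : forall s, a <= s <= t -> g s <= `|G| / 2 ^+ i.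
    elim: i => [|i IHi] s /andP[as_ st].
      by rewrite expr0 divr1 gG// (le_trans a0 as_) (le_trans st tT).
    have Mi0 : 0 <= `|G| / 2 ^+ i by rewrite divr_ge0// exprn_ge0.
    have := H a s (`|G| / 2 ^+ i) a0 as_ (le_trans st tT).
    have h r : a <= r <= s -> g r <= `|G| / 2 ^+ i.
      by move=> /andP[ar rs]; apply: IHi; rewrite ar (le_trans rs st).
    move=> /(_ h) gs.
    have : k * (`|G| / 2 ^+ i) * (s - a) <= (`|G| / 2 ^+ i) * 2^-1.
      move: (`|G| / _) Mi0 => y y0; rewrite [k * y]mulrC -mulrA ler_wpM2l//.
      by rewrite (le_trans _ kdel)// ler_wpM2l//; lra.
    rewrite exprSr invfM mulrA; lra.
  apply/ler_addgt0Pr => e e0; rewrite add0r.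
  have : (fun i => `|G| / 2 ^+ i) @ \oo --> (0 : R).
    rewrite -(mulr0 `|G|); apply: cvgMr.
    under eq_fun do rewrite -exprVn.
    by apply: cvg_expr; rewrite ger0_norm ?invr_ge0// invf_lt1// ltr1n.
  move=> /cvgrPdist_le/(_ e e0) [i _ /(_ i (leqnn i))]; rewrite sub0r normrN.
  rewrite ger0_norm ?divr_ge0 ?exprn_ge0// => hi.
  by rewrite (le_trans (halve i t _))// (ltW jt) lexx.
apply: (step (Num.truncn (T / del)).+1); first by rewrite T0 lexx.
by rewrite -ler_pdivrMr//; exact/ltW/truncnS_gt.
Qed.

End real_functions.

(** * The contraction estimate *)

Section exchange_in_time.
Variable R : realType.
Local Notation X := (measurableTypeR R).
Local Notation mu := (@lebesgue_measure R).
Variables (K : X * X * X -> R) (c : R -> R).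
Hypotheses (mK : measurable_fun setT K) (K_ge0 : forall p, 0 <= K p)
  (K_le : forall p, K p <= weight p.1.1 * weight p.1.2 * c p.2)
  (hc : has_moment c) (c_ge0 : forall z, 0 <= c z).
Variables (T C : R) (u : R -> R -> R).
Hypotheses (T_ge0 : 0 <= T)
  (hu : forall t, 0 <= t <= T -> has_moment (u t))
  (uC : forall t, 0 <= t <= T -> moment (u t) <= C)
  (pu : measurable_pairings `[0, T] mu u).

Let in_itv0 t s : 0 <= t <= T -> `[0, t]%classic s -> 0 <= s <= T.
Proof.
by move=> /andP[t0 tT]; rewrite /= in_itv/= => /andP[-> st]; rewrite (le_trans st).
Qed.

Lemma norm_exchange_self_le (w : R -> R) (M s : R) : measurable_fun setT w ->
  (forall x, `|w x| <= M) -> 0 <= s <= T ->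
  `|exchange K w (u s) (u s)| <= 4 * M * C * C * rate c.
Proof.
move=> mw wM sT; have hus := hu sT.
have M0 : 0 <= M by rewrite (le_trans _ (wM 0)).
have uC' := le_trans (half_moment_le hus) (uC sT).
rewrite (le_trans (norm_exchange_le mK K_ge0 K_le hc mw wM hus hus))//.
have u0 := half_moment_ge0 (u s); have r0 := rate_ge0 c_ge0.
by rewrite ler_wpM2r// ler_pM ?mulr_ge0// ler_wpM2l// mulr_ge0.
Qed.

Lemma integrable_exchange_in_time (w : R -> R) t : bounded_mfun w -> 0 <= t <= T ->
  mu.-integrable `[0, t] (EFin \o (fun s => exchange K w (u s) (u s))).
Proof.
move=> bw tT; have [mw [M wM]] := bw.
apply: measurable_bounded_integrable => //.
- by rewrite /= lebesgue_measure_itv/=; case: ifP => _ //; rewrite -EFinB ltry.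
- have TT : 0 <= T <= T by rewrite T_ge0 lexx.
  have mg : measurable_fun `[0, T] (fun s => exchange K w (u s) (u s)).
    by apply: (measurable_exchange mK K_ge0 K_le hc c_ge0).
  have sub : (`[0, t] : set R) `<=` `[0, T].
    by move=> s st; rewrite /= in_itv; exact: in_itv0 tT st.
  have mI : measurable (`[0, T] : set R) by [].
  have mg' := measurable_funS mI sub mg.
  exact: mg'.
- exists (4 * M * C * C * rate c); split; rewrite ?num_real // => B MB s st.
  apply: (le_trans _ (ltW MB)); apply: norm_exchange_self_le => //.
  exact: in_itv0 tT st.
Qed.

End exchange_in_time.

Section uniqueness.
Variable R : realType.
Local Notation X := (measurableTypeR R).
Local Notation mu := (@lebesgue_measure R).
Local Notation integrable f := (mu.-integrable setT (EFin \o f)).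

Variables (K : X * X * X -> R) (c : R -> R).
Hypotheses (mK : measurable_fun setT K) (K_ge0 : forall p, 0 <= K p)
  (K_supp : forall p, K p != 0 -> [/\ 0 < p.1.1, 0 < p.1.2 & 0 < p.2 < p.1.1])
  (K_le : forall p, K p <= weight p.1.1 * weight p.1.2 * c p.2)
  (hc : has_moment c) (c_ge0 : forall z, 0 <= c z).

Variables (T C : R) (u v : R -> R -> R).
Hypotheses (T_ge0 : 0 <= T)
  (hu : forall t, 0 <= t <= T -> has_moment (u t))
  (hv : forall t, 0 <= t <= T -> has_moment (v t))
  (u_ge0 : forall t x, 0 <= u t x) (v_ge0 : forall t x, 0 <= v t x)
  (uC : forall t, 0 <= t <= T -> moment (u t) <= C)
  (vC : forall t, 0 <= t <= T -> moment (v t) <= C)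
  (pu : measurable_pairings `[0, T] mu u) (pv : measurable_pairings `[0, T] mu v).

Let E t x := u t x - v t x.

(** The right-hand side of the equation for the difference of two solutions. *)
Definition exchange_gap (w : R -> R) (s : R) : R :=
  exchange K w (u s) (u s) - exchange K w (v s) (v s).

Hypothesis weak_eq : forall t (w : R -> R), 0 <= t <= T -> bounded_mfun w ->
  \int[mu]_x (w x * E t x) = \int[mu]_(s in `[0, t]) exchange_gap w s.

Let C_ge0 : 0 <= C.
Proof. by rewrite (le_trans (moment_ge0 (u 0)))// uC// lexx. Qed.

Let hE t : 0 <= t <= T -> has_moment (E t).
Proof. by move=> tT; apply: has_momentB; [exact: hu|exact: hv]. Qed.

Let EC t : 0 <= t <= T -> moment (E t) <= 2 * C.
Proof.
move=> tT; rewrite (le_trans (momentB_le (hu tT) (hv tT)))//.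
by have := uC tT; have := vC tT; lra.
Qed.

Let in_itv0 t s : 0 <= t <= T -> `[0, t]%classic s -> 0 <= s <= T.
Proof.
by move=> /andP[t0 tT]; rewrite /= in_itv/= => /andP[-> st]; rewrite (le_trans st).
Qed.

Lemma norm_exchange_gap_le (w : R -> R) (M s : R) : measurable_fun setT w ->
  (forall x, `|w x| <= M) -> 0 <= s <= T ->
  `|exchange_gap w s| <= 8 * M * C * C * rate c.
Proof.
move=> mw wM sT; rewrite (le_trans (ler_normB _ _))//.
have := norm_exchange_self_le mK K_ge0 K_le hc c_ge0 hu uC mw wM sT.
have := norm_exchange_self_le mK K_ge0 K_le hc c_ge0 hv vC mw wM sT.
lra.
Qed.

Lemma integrable_exchange_gap (w : R -> R) t : bounded_mfun w -> 0 <= t <= T ->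
  mu.-integrable `[0, t] (EFin \o exchange_gap w).
Proof.
move=> bw tT; have mI : measurable (`[0, t]%classic : set X) by exact: measurable_itv.
have ui := integrable_exchange_in_time mK K_ge0 K_le hc c_ge0 T_ge0 hu uC pu bw tT.
have vi := integrable_exchange_in_time mK K_ge0 K_le hc c_ge0 T_ge0 hv vC pv bw tT.
have /= h := integrableB mI ui vi; exact: h.
Qed.

Lemma increment_le (w : R -> R) (s t B : R) : bounded_mfun w ->
  0 <= s -> s <= t -> t <= T ->
  (forall r, s <= r <= t -> exchange_gap w r <= B) ->
  \int[mu]_x (w x * E t x) - \int[mu]_x (w x * E s x) <= B * (t - s).
Proof.
move=> bw s0 st tT gB.
have hs : 0 <= s <= T by rewrite s0 (le_trans st).
have ht : 0 <= t <= T by rewrite (le_trans s0 st).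
rewrite !weak_eq//.
rewrite Rintegral_itvB//; last exact: integrable_exchange_gap.
have gi : mu.-integrable `]s, t] (EFin \o exchange_gap w).
  apply: integrableS (integrable_exchange_gap bw ht) => //.
  by apply: subset_itvr; rewrite bnd_simp.
apply: (@le_trans _ _ (\int[mu]_(r in `]s, t]) (cst B r))).
  apply: le_Rintegral => //.
    apply: measurable_bounded_integrable => //.
      by rewrite /= lebesgue_measure_itv/=; case: ifP => _ //; rewrite -EFinB ltry.
    by exact: bounded_cst.
  by move=> r /=; rewrite in_itv/= => /andP[sr rt]; apply: gB; rewrite ltW.
rewrite Rintegral_cst//= lebesgue_measure_itv/= lte_fin.
case: ltP => [_|ts]; first by rewrite -EFinB.
by have -> : t = s; [apply/eqP; rewrite eq_le ts st|rewrite subrr].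
Qed.

Let sg_test (f : R -> R) : measurable_fun setT f -> bounded_mfun (Num.sg \o f).
Proof.
move=> mf; split; first by apply: measurableT_comp => //; exact: measurable_sgr.
by exists 1 => x; rewrite normr_sg lern1 leq_b1.
Qed.

Let mE t : 0 <= t <= T -> measurable_fun setT (E t).
Proof. by move=> /hE[]. Qed.

Let iE t : 0 <= t <= T -> integrable (E t).
Proof. by move=> /hE; exact: has_moment_integrable. Qed.

(** Test the equation with the sign of the difference of the two values, for which
the right-hand side is bounded by the moments. *)
Lemma lipschitz_L1 (s t : R) : 0 <= s -> s <= t -> t <= T ->
  \int[mu]_x `|E t x - E s x| <= 8 * C * C * rate c * (t - s).
Proof.
move=> s0 st tT.
have hs : 0 <= s <= T by rewrite s0 (le_trans st).
have ht : 0 <= t <= T by rewrite (le_trans s0 st).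
have md : measurable_fun setT (fun x => E t x - E s x).
  by apply: measurable_funB; exact: mE.
have bw := sg_test md; set w := Num.sg \o _ in bw.
have w1 x : `|w x| <= 1 by rewrite normr_sg lern1 leq_b1.
have -> : \int[mu]_x `|E t x - E s x| =
    \int[mu]_x (w x * E t x) - \int[mu]_x (w x * E s x).
  rewrite -RintegralB//; last 2 first.
  - by apply: integrable_bounded_mul => //; exact: iE.
  - by apply: integrable_bounded_mul => //; exact: iE.
  by apply: eq_Rintegral => x _; rewrite normrEsg mulrBr.
apply: increment_le => // r /andP[sr rt].
rewrite (le_trans (ler_norm _))//.
rewrite (le_trans (norm_exchange_gap_le (proj1 bw) w1 _)) ?mulr1//.
by rewrite (le_trans s0 sr) (le_trans rt tT).
Qed.

(** Arithmetic-geometric mean: [weight x <= eta * weight x ^ 2 + 1 / (4 eta)]. *)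
Let half_moment_interp (f : R -> R) (eta : R) : 0 < eta -> has_moment f ->
  half_moment f <= eta * moment f + (4 * eta)^-1 * \int[mu]_x `|f x|.
Proof.
move=> eta0 hf; have [_ fi] := hf.
have fi' := integrable_normr (has_moment_integrable hf).
rewrite -!RintegralZl// -RintegralD//; last 2 first.
- exact: integrable_scale.
- exact: integrable_scale.
apply: le_Rintegral => //.
- exact: has_moment_integrable_half.
- have := integrable_lin 1 (integrable_scale eta fi) (integrable_scale (4 * eta)^-1 fi').
  by under [X in EFin \o X]eq_fun do rewrite mul1r.
move=> x _; rewrite -weight_sqr mulrA -mulrDl ler_wpM2r//.
have : 0 <= (2 * eta * weight x - 1) ^+ 2 / (4 * eta).
  by rewrite divr_ge0 ?sqr_ge0 ?mulr_ge0// ltW.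
rewrite [X in 0 <= X -> _](_ : _ =
  eta * (weight x * weight x) + (4 * eta)^-1 - weight x); last first.
  by field; rewrite gt_eqF.
by rewrite subr_ge0.
Qed.

(** Interpolation between the Lipschitz bound in L^1 and the bounded first
moments: [eta] makes the first moment contribute at most [eps / 2], and [del] then
does the same for the L^1 norm. *)
Lemma half_moment_uniformly_continuous (eps : R) : 0 < eps ->
  exists2 del : R, 0 < del & forall s t, 0 <= s -> s <= t -> t <= T ->
    t - s <= del -> half_moment (fun x => E t x - E s x) <= eps.
Proof.
move=> eps0.
have C1 : 0 < C + 1 by have := C_ge0; lra.
pose eta := eps / (8 * (C + 1)).
have eta0 : 0 < eta by rewrite divr_gt0// mulr_gt0.
have eta_ge0 := ltW eta0; have eps_ge0 := ltW eps0.
pose L := 8 * C * C * rate c.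
have L0 : 0 <= L by rewrite !mulr_ge0// ?C_ge0// rate_ge0.
have L1 : 0 < L + 1 by lra.
exists (2 * eta * eps / (L + 1)).
  by apply: divr_gt0 => //; apply: mulr_gt0 => //; apply: mulr_gt0.
move=> s t s0 st tT tsd.
have hs : 0 <= s <= T by rewrite s0 (le_trans st).
have ht : 0 <= t <= T by rewrite (le_trans s0 st).
have hd : has_moment (fun x => E t x - E s x) by apply: has_momentB; exact: hE.
rewrite (le_trans (half_moment_interp eta0 hd))//.
have m1 : moment (fun x => E t x - E s x) <= 4 * C.
  rewrite (le_trans (momentB_le (hE ht) (hE hs)))//.
  by have := EC ht; have := EC hs; lra.
have h1 : eta * moment (fun x => E t x - E s x) <= eps / 2.
  rewrite (le_trans (ler_wpM2l (ltW eta0) m1))//.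
  have -> : eta * (4 * C) = eps / 2 * (C / (C + 1)).
    by rewrite /eta; field; rewrite gt_eqF.
  by rewrite ler_piMr ?divr_ge0 ?(ltW eps0)// ler_pdivrMr// mul1r; lra.
have h2 : \int[mu]_x `|E t x - E s x| <= 2 * eta * eps.
  rewrite (le_trans (lipschitz_L1 s0 st tT))// -/L.
  rewrite (le_trans (ler_wpM2l L0 tsd))// mulrCA ler_piMr//.
    by apply: mulr_ge0 => //; apply: mulr_ge0.
  by rewrite ler_pdivrMr// mul1r; lra.
have h3 : (4 * eta)^-1 * \int[mu]_x `|E t x - E s x| <= eps / 2.
  have i0 : 0 <= (4 * eta)^-1 by rewrite invr_ge0 mulr_ge0.
  rewrite (le_trans (ler_wpM2l i0 h2))//.
  have e0 : eta != 0 by rewrite gt_eqF.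
  by rewrite [leLHS](_ : _ = eps / 2)//; move: (eta) e0 => x x0; field.
lra.
Qed.

Let kappa := \int[mu]_z (weight z * c z).

Let kappa_ge0 : 0 <= kappa.
Proof. by apply: Rintegral_ge0 => z _; rewrite mulr_ge0// weight_ge0. Qed.

(** Polarize the quadratic difference at time [s] as
[B (E s) (u s) + B (v s) (E s)], and replace [E s] by [E t], to whose sign the test
function is adapted.  The replacement costs a constant that depends on [n], but is
multiplied by [eps]. *)
Lemma exchange_gap_signed_le (n : nat) (s t eps : R) :
  0 <= s <= T -> 0 <= t <= T ->
  half_moment (fun x => E t x - E s x) <= eps ->
  exchange_gap (signed_weight n (E t)) s <=
    6 * C * kappa * half_moment (E t) + 8 * n%:R * C * rate c * eps.
Proof.
move=> sT tT heps; set w := signed_weight n (E t).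
have bw : bounded_mfun w := bounded_signed_weight n (hE tT).
have wn x : `|w x| <= n%:R.
  by rewrite (le_trans (norm_signed_weight_le _ _ _))// capped_weight_le_nat.
have r0 := rate_ge0 c_ge0.
have het := hE tT; have hes := hE sT; have hd := has_momentB het hes.
have hus := hu sT; have hvs := hv sT.
have h0 := half_moment_ge0 (E t); have d0 := half_moment_ge0 (fun x => E t x - E s x).
have -> : exchange_gap w s =
    exchange K w (E t) (u s) - exchange K w (fun x => E t x - E s x) (u s) +
    (exchange K w (v s) (E t) - exchange K w (v s) (fun x => E t x - E s x)).
  rewrite (exchange_linl mK K_ge0 K_le hc bw het hes hus).
  rewrite (exchange_linr mK K_ge0 K_le hc bw hvs het hes).
  rewrite (exchange_linl mK K_ge0 K_le hc bw hus hvs hus).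
  rewrite (exchange_linr mK K_ge0 K_le hc bw hvs hus hvs).
  rewrite /exchange_gap; ring.
have small f : has_moment f -> moment f <= C ->
    4 * n%:R * half_moment (fun x => E t x - E s x) * half_moment f * rate c
    <= 4 * n%:R * C * rate c * eps.
  move=> hf fC; have fC' := le_trans (half_moment_le hf) fC.
  rewrite [leRHS](_ : _ = 4 * n%:R * eps * C * rate c); last by ring.
  rewrite ler_wpM2r// ler_pM ?mulr_ge0 ?half_moment_ge0//.
  by rewrite ler_wpM2l// mulr_ge0.
have main f : 0 <= moment f -> moment f <= C ->
    3 * half_moment (E t) * moment f * kappa <= 3 * C * kappa * half_moment (E t).
  move=> f0 fC.
  rewrite [leRHS](_ : _ = 3 * half_moment (E t) * C * kappa); last by ring.
  by rewrite ler_wpM2r// ler_wpM2l// mulr_ge0.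
have h1 : exchange K w (E t) (u s) <= 3 * C * kappa * half_moment (E t).
  apply: le_trans (main _ (moment_ge0 _) (uC sT)).
  exact: exchange_signed_weightl.
have h2 : exchange K w (v s) (E t) <= 3 * C * kappa * half_moment (E t).
  apply: le_trans (main _ (moment_ge0 _) (vC sT)).
  rewrite [leRHS](_ : _ = 3 * moment (v s) * half_moment (E t) * kappa); last by ring.
  exact: exchange_signed_weightr.
have h3 : `|exchange K w (fun x => E t x - E s x) (u s)| <= 4 * n%:R * C * rate c * eps.
  apply: le_trans (small _ hus (uC sT)).
  exact: (norm_exchange_le mK K_ge0 K_le hc (proj1 bw) wn hd hus).
have h4 : `|exchange K w (v s) (fun x => E t x - E s x)| <= 4 * n%:R * C * rate c * eps.
  apply: le_trans (small _ hvs (vC sT)).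
  rewrite [leRHS](_ : _ = 4 * n%:R * half_moment (v s) *
    half_moment (fun x => E t x - E s x) * rate c); last by ring.
  exact: (norm_exchange_le mK K_ge0 K_le hc (proj1 bw) wn hvs hd).
by move: h3 h4; rewrite !ler_norml => /andP[? ?] /andP[? ?]; lra.
Qed.

Let capped_moment n t := \int[mu]_x (capped_weight n x * `|E t x|).

Let capped_integrable n t : 0 <= t <= T ->
  integrable (fun x => capped_weight n x * `|E t x|).
Proof.
move=> tT; apply: (integrable_dominated _ (has_moment_integrable_half (hE tT))).
  apply: measurable_funM; first exact: measurable_capped_weight.
  by apply: measurableT_comp => //; exact: mE.
move=> x; rewrite ger0_norm; first by rewrite ler_wpM2r// capped_weight_le.
by rewrite mulr_ge0// capped_weight_ge0.
Qed.

Let capped_momentE n t : 0 <= t <= T ->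
  capped_moment n t = \int[mu]_x (signed_weight n (E t) x * E t x).
Proof. by move=> tT; apply: eq_Rintegral => x _; rewrite signed_weight_mul. Qed.

Let capped_moment_le n t : 0 <= t <= T -> capped_moment n t <= half_moment (E t).
Proof.
move=> tT; apply: le_Rintegral => //.
- exact: capped_integrable.
- exact: has_moment_integrable_half (hE tT).
by move=> x _; rewrite ler_wpM2r// capped_weight_le.
Qed.

Let capped_moment_cvg t : 0 <= t <= T ->
  (fun n => capped_moment n t) @ \oo --> half_moment (E t).
Proof.
move=> tT; apply: (@Rintegral_dominated_cvg _ X R mu setT
    (fun n x => capped_weight n x * `|E t x|) (fun x => weight x * `|E t x|)
    (fun x => weight x * `|E t x|)) => //.
- by move=> n; exact: integrable_measurable (capped_integrable n tT).
- by move=> x _; apply: cvgMl; exact: cvg_capped_weight.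
- exact: has_moment_integrable_half (hE tT).
move=> n x _; rewrite ger0_norm; first by rewrite ler_wpM2r// capped_weight_le.
by rewrite mulr_ge0// capped_weight_ge0.
Qed.

Let half_moment_le_of_capped t B : 0 <= t <= T ->
  (forall n, capped_moment n t <= B) -> half_moment (E t) <= B.
Proof.
move=> tT H; have h := capped_moment_cvg tT.
rewrite -(cvg_lim (@Rhausdorff R) h); apply: limr_le.
  by apply/cvg_ex; exists (half_moment (E t)).
by apply: nearW => n; exact: H.
Qed.

(** The signed weight at the end [t] of a step gives the exact value of the
capped moment at [t] and a lower bound of the one at [s], which is the convexity
inequality |b| - |a| <= sgn b (b - a). *)
Lemma capped_moment_increment n a b M : 0 <= a -> a <= b -> b <= T ->
  (forall t, a <= t <= b -> half_moment (E t) <= M) ->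
  capped_moment n b - capped_moment n a <= 6 * C * kappa * M * (b - a).
Proof.
move=> a0 ab bT HM; have r0 := rate_ge0 c_ge0.
apply: le_increment_of_local => // eps eps0.
pose D := 8 * n%:R * C * rate c.
have D0 : 0 <= D by rewrite !mulr_ge0// C_ge0.
have D1 : 0 < D + 1 by lra.
have eps'0 : 0 < eps / (D + 1) by rewrite divr_gt0.
have [del del0 Hdel] := half_moment_uniformly_continuous eps'0.
exists del => // s t as_ st tb tsd.
have s0 := le_trans a0 as_; have tT := le_trans tb bT.
have hs : 0 <= s <= T by rewrite s0 (le_trans st).
have ht : 0 <= t <= T by rewrite (le_trans s0 st).
have bw := bounded_signed_weight n (hE ht).
have h1 : \int[mu]_x (signed_weight n (E t) x * E s x) <= capped_moment n s.
  apply: le_Rintegral => //.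
  - by apply: integrable_bounded_mul => //; exact: iE.
  - exact: capped_integrable.
  move=> x _; rewrite (le_trans (ler_norm _))// normrM ler_wpM2r//.
  exact: norm_signed_weight_le.
have h2 := @increment_le (signed_weight n (E t)) s t
  (6 * C * kappa * M + eps) bw s0 st tT.
rewrite capped_momentE//; apply: le_trans (h2 _); first by rewrite lerD2l lerN2.
move=> r /andP[sr rt].
have hr : 0 <= r <= T by rewrite (le_trans s0 sr) (le_trans rt).
have dr : half_moment (fun x => E t x - E r x) <= eps / (D + 1).
  by apply: Hdel => //; [exact: le_trans sr|lra].
rewrite (le_trans (exchange_gap_signed_le n hr ht dr))// -/D lerD//.
  by rewrite ler_wpM2l ?mulr_ge0 ?C_ge0// HM// tb (le_trans as_ st).
by rewrite mulrCA ler_piMr ?(ltW eps0)// ler_pdivrMr// mul1r; lra.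
Qed.

Lemma half_moment_gap_eq0 : half_moment (E T) = 0.
Proof.
apply/eqP; rewrite eq_le half_moment_ge0 andbT.
apply: (@gronwall_zero _ (fun t => half_moment (E t)) T (6 * C * kappa) (2 * C)) => //.
- by rewrite !mulr_ge0// C_ge0.
- have h0 : (0 : R) <= 0 <= T by rewrite lexx.
  apply: half_moment_le_of_capped => // n; rewrite capped_momentE//.
  have bw := bounded_signed_weight n (hE h0).
  by rewrite (weak_eq h0 bw) set_itv1 Rintegral_set1.
- by move=> t tT; rewrite (le_trans (half_moment_le (hE tT)))// EC.
- move=> a b M a0 ab bT HM.
  have ha : 0 <= a <= T by rewrite a0 (le_trans ab).
  have hb : 0 <= b <= T by rewrite (le_trans a0 ab).
  apply: half_moment_le_of_capped => // n.
  have := capped_moment_increment n a0 ab bT HM; have := capped_moment_le n ha.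
  by move: (6 * C * kappa * M * _) => z; lra.
Qed.

End uniqueness.

(** * From smooth to bounded test functions *)

Section gompertz.
Variable R : realType.
Implicit Types (k m x : R) (p : {poly R}).

(** Smooth functions with values in [0, 1] whose pointwise limits include the
indicators of rays, endpoints included, by [cvg_gompertz_indic]. *)
Definition gompertz k m x : R := expR (- expR (k * x + m)).

Let is_derive_inner k m x :
  is_derive x 1 (fun y => expR (k * y + m)) (expR (k * x + m) * k).
Proof.
have h : is_derive x 1 (horner (k *: 'X + m%:P)) k.
  by apply: is_derive_eq; rewrite derivD derivZ derivX derivC !hornerE.
have E y : (k *: 'X + m%:P).[y] = k * y + m by rewrite !hornerE.
have := is_derive1_comp (is_derive_expR (k *: 'X + m%:P).[x]) h.
by rewrite E; congr (is_derive _ _ _ _); apply/funext => y /=; rewrite E.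
Qed.

Let is_derive_gompertz_poly k m p x :
  is_derive x 1 (fun y => p.[expR (k * y + m)] * gompertz k m y)
    ((k *: ('X * (p^`() - p))).[expR (k * x + m)] * gompertz k m x).
Proof.
have h1 := is_derive_inner k m x.
have h2 : is_derive x 1 (fun y => p.[expR (k * y + m)])
    (p^`().[expR (k * x + m)] * (expR (k * x + m) * k)).
  exact: (@is_derive1_comp _ (horner p) (fun y => expR (k * y + m))).
have h3 : is_derive x 1 (gompertz k m)
    (gompertz k m x * (- (expR (k * x + m) * k))).
  have h1' : is_derive x 1 (fun y => - expR (k * y + m)) (- (expR (k * x + m) * k)).
    exact: (is_deriveN h1).
  exact: (@is_derive1_comp R expR (fun y => - expR (k * y + m)) x _ _
    (is_derive_expR _) h1').
have h4 := is_deriveM h2 h3.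
have E : p.[expR (k * x + m)] *: (gompertz k m x * - (expR (k * x + m) * k)) +
    gompertz k m x *: (p^`().[expR (k * x + m)] * (expR (k * x + m) * k)) =
    (k *: ('X * (p^`() - p))).[expR (k * x + m)] * gompertz k m x.
  by rewrite !hornerE /GRing.scale/=; ring.
by rewrite -E; exact: h4.
Qed.

(** Every derivative is a polynomial in [expR (k * x + m)] times the function
itself. *)
Lemma smooth_gompertz k m : smooth_pos (gompertz k m).
Proof.
have H n : exists p, derive1n n (gompertz k m) =
    fun y => p.[expR (k * y + m)] * gompertz k m y.
  elim: n => [|n [p IH]].
    by exists 1 => /=; apply/funext => y; rewrite hornerE mul1r.
  exists (k *: ('X * (p^`() - p))); rewrite derive1nS IH.
  apply/funext => y; rewrite derive1E.
  by have h := is_derive_gompertz_poly k m p y; rewrite derive_val.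
move=> n x _; have [p ->] := H n.
by have [] := is_derive_gompertz_poly k m p x.
Qed.

Lemma gompertz_bound k m x : 0 <= gompertz k m x <= 1.
Proof. by rewrite expR_ge0/= -[leRHS]expR0 ler_expR oppr_le0 expR_ge0. Qed.

Lemma measurable_gompertz k m : measurable_fun setT (gompertz k m).
Proof.
apply: measurableT_comp; first exact: measurable_expR.
apply: measurableT_comp => //.
apply: measurableT_comp; first exact: measurable_expR.
by apply: measurable_funD => //; exact: measurable_funM.
Qed.

(** The slope grows like n^2 and the shift like n, so that the inner exponent
tends to -oo for [x < a], and to +oo for [x >= a], equality included. *)
Lemma cvg_gompertz_indic (a x : R) :
  (fun n : nat => gompertz (n%:R ^+ 2) (n%:R - n%:R ^+ 2 * a) x) @ \oo -->
  (\1_(`]-oo, a[) x : R).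
Proof.
have E n : n%:R ^+ 2 * x + (n%:R - n%:R ^+ 2 * a) = n%:R ^+ 2 * (x - a) + n%:R :> R.
  by ring.
rewrite indicE; have [xa|ax] := ltP x a.
  rewrite mem_set; last by rewrite /= in_itv.
  apply: (@squeeze_cvgr _ _ _ _ (fun n : nat => 1 - n.+1%:R^-1) (cst 1)).
  - near=> n; rewrite /= (andP (gompertz_bound _ _ _)).2 andbT /gompertz E.
    have n2 : 2 / (a - x) <= n%:R by near: n; exact: nbhs_infty_ger.
    have ax0 : 0 < a - x by rewrite subr_gt0.
    have hn : n%:R <= - (n%:R ^+ 2 * (x - a) + n%:R) :> R.
      rewrite ler_pdivrMr// in n2.
      have : 0 <= n%:R * (n%:R * (a - x) - 2) :> R by rewrite mulr_ge0// subr_ge0.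
      by move: (n%:R) => N; nra.
    have h1 : expR (n%:R ^+ 2 * (x - a) + n%:R) <= n.+1%:R^-1.
      rewrite -[X in expR X]opprK expRN lef_pV2 ?posrE ?expR_gt0//.
      by rewrite (le_trans _ (expR_ge1Dx _))// -natr1 addrC lerD2l.
    by apply: le_trans (expR_ge1Dx _); rewrite lerD2l lerN2.
  - rewrite -[X in _ --> X]subr0; apply: cvgB; first exact: cvg_cst.
    exact: cvg_harmonic.
  - exact: cvg_cst.
rewrite memNset; last by rewrite /= in_itv/= ltNge ax.
apply: (@squeeze_cvgr _ _ _ _ (cst 0) (fun n : nat => n.+1%:R^-1)).
- near=> n; rewrite /= {1}/gompertz expR_ge0/= /gompertz E expRN.
  rewrite lef_pV2 ?posrE ?expR_gt0//.
  apply: le_trans (expR_ge1Dx _); rewrite -natr1 addrC lerD2l.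
  apply: le_trans (expR_ge1Dx _).
  have : 0 <= n%:R ^+ 2 * (x - a) by rewrite mulr_ge0// ?sqr_ge0// subr_ge0.
  by lra.
- exact: cvg_cst.
- exact: cvg_harmonic.
Unshelve. all: by end_near.
Qed.

End gompertz.

Section from_smooth_to_bounded.
Variable R : realType.
Local Notation X := (measurableTypeR R).
Local Notation mu := (@lebesgue_measure R).
Variables (K : X * X * X -> R) (c : R -> R).
Hypotheses (mK : measurable_fun setT K) (K_ge0 : forall p, 0 <= K p)
  (K_le : forall p, K p <= weight p.1.1 * weight p.1.2 * c p.2)
  (hc : has_moment c) (c_ge0 : forall z, 0 <= c z).
Variables (T C : R) (u v : R -> R -> R).
Hypotheses (T_ge0 : 0 <= T)
  (hu : forall t, 0 <= t <= T -> has_moment (u t))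
  (hv : forall t, 0 <= t <= T -> has_moment (v t))
  (uC : forall t, 0 <= t <= T -> moment (u t) <= C)
  (vC : forall t, 0 <= t <= T -> moment (v t) <= C)
  (pu : measurable_pairings `[0, T] mu u) (pv : measurable_pairings `[0, T] mu v).
Hypothesis smooth_eq : forall t (w : R -> R), 0 <= t <= T -> smooth_pos w ->
  measurable_fun setT w -> (forall x, 0 <= w x <= 1) ->
  \int[mu]_x (w x * (u t x - v t x)) = \int[mu]_(s in `[0, t]) exchange_gap K u v w s.

(** Both sides are linear in the test function and pass to bounded pointwise
limits, so the functional monotone class theorem applies with the rays as
pi-system. *)
Lemma weak_eq_bounded t (w : R -> R) : 0 <= t <= T -> bounded_mfun w ->
  \int[mu]_x (w x * (u t x - v t x)) = \int[mu]_(s in `[0, t]) exchange_gap K u v w s.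
Proof.
move=> tT.
have hE : has_moment (fun x => u t x - v t x) by apply: has_momentB; [exact: hu|exact: hv].
have iE := has_moment_integrable hE.
have ig w' : bounded_mfun w' -> mu.-integrable `[0, t] (EFin \o exchange_gap K u v w').
  by move=> bw; exact: (integrable_exchange_gap mK K_ge0 K_le hc c_ge0 T_ge0 hu hv uC vC pu pv).
have itv0 s : `[0, t]%classic s -> 0 <= s <= T.
  rewrite /= in_itv/= => /andP[-> st]; case/andP: tT => _.
  exact: le_trans.
have gomp (k m : R) : \int[mu]_x (gompertz k m x * (u t x - v t x)) =
    \int[mu]_(s in `[0, t]) exchange_gap K u v (gompertz k m) s.
  apply: smooth_eq => //; first exact: smooth_gompertz.
    exact: measurable_gompertz.
  exact: gompertz_bound.
have bg (k m : R) : bounded_mfun (gompertz k m).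
  split; first exact: measurable_gompertz.
  by exists 1 => x; case/andP: (gompertz_bound k m x) => g0 g1; rewrite ger0_norm.
have lin (a : R) (f g : R -> R) : bounded_mfun f -> bounded_mfun g ->
    \int[mu]_x (f x * (u t x - v t x)) = \int[mu]_(s in `[0, t]) exchange_gap K u v f s ->
    \int[mu]_x (g x * (u t x - v t x)) = \int[mu]_(s in `[0, t]) exchange_gap K u v g s ->
    \int[mu]_x ((a * f x + g x) * (u t x - v t x)) =
    \int[mu]_(s in `[0, t]) exchange_gap K u v (fun x => a * f x + g x) s.
  move=> bf bgg Hf Hg.
  transitivity (a * \int[mu]_x (f x * (u t x - v t x)) +
      \int[mu]_x (g x * (u t x - v t x))).
    rewrite -Rintegral_lin; last 2 first.
    - exact: integrable_bounded_mul.
    - exact: integrable_bounded_mul.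
    by apply: eq_Rintegral => x _; ring.
  have mI : measurable (`[0, t]%classic : set X) by exact: measurable_itv.
  rewrite Hf Hg -(Rintegral_lin_on a mI (ig f bf) (ig g bgg)).
  apply: eq_Rintegral => s /set_mem /itv0 sT; rewrite /exchange_gap.
  rewrite !(exchange_linw mK K_ge0 K_le hc)//; try exact: hu; try exact: hv.
  ring.
have lim (f_ : nat -> R -> R) (f : R -> R) (M : R) :
    (forall n, measurable_fun setT (f_ n)) -> (forall n x, `|f_ n x| <= M) ->
    (forall x, f_ ^~ x @ \oo --> f x) ->
    (forall n, \int[mu]_x (f_ n x * (u t x - v t x)) =
       \int[mu]_(s in `[0, t]) exchange_gap K u v (f_ n) s) ->
    \int[mu]_x (f x * (u t x - v t x)) = \int[mu]_(s in `[0, t]) exchange_gap K u v f s.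
  move=> mf fM ff Hn.
  have h1 : (fun n => \int[mu]_x (f_ n x * (u t x - v t x))) @ \oo -->
      \int[mu]_x (f x * (u t x - v t x)).
    apply: (@Rintegral_dominated_cvg _ X R mu setT
      (fun n x => f_ n x * (u t x - v t x)) (fun x => f x * (u t x - v t x))
      (fun x => M * `|u t x - v t x|)) => //.
    - move=> n; apply: measurable_funM; first exact: mf.
      exact: integrable_measurable iE.
    - by move=> x _; apply: cvgMl; exact: ff.
    - exact: (integrable_scale M (integrable_normr iE)).
    - by move=> n x _; rewrite normrM ler_wpM2r.
  have bfn n : bounded_mfun (f_ n) by split => //; exists M.
  have h2 : (fun n => \int[mu]_(s in `[0, t]) exchange_gap K u v (f_ n) s) @ \oo -->
      \int[mu]_(s in `[0, t]) exchange_gap K u v f s.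
    apply: (@Rintegral_dominated_cvg _ X R mu `[0, t]
      (fun n s => exchange_gap K u v (f_ n) s) (fun s => exchange_gap K u v f s)
      (fun=> 8 * M * C * C * rate c)) => //.
    - by move=> n; have /measurable_int/measurable_EFinP := ig _ (bfn n).
    - move=> s /itv0 sT; apply: cvgB.
        by apply: (cvg_exchange mK K_ge0 K_le hc c_ge0 mf fM ff); exact: hu.
      by apply: (cvg_exchange mK K_ge0 K_le hc c_ge0 mf fM ff); exact: hv.
    - apply: measurable_bounded_integrable => //.
        by rewrite /= lebesgue_measure_itv/=; case: ifP => _ //; rewrite -EFinB ltry.
      exact: bounded_cst.
    - move=> n s /itv0 sT.
      by apply: (norm_exchange_gap_le mK K_ge0 K_le hc c_ge0 hu hv uC vC).
  have h3 : (fun n => \int[mu]_x (f_ n x * (u t x - v t x))) =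
    (fun n => \int[mu]_(s in `[0, t]) exchange_gap K u v (f_ n) s) by apply/funext.
  rewrite -(cvg_lim (@Rhausdorff R) h1) h3; exact: (cvg_lim (@Rhausdorff R) h2).
pose P (w : R -> R) := \int[mu]_x (w x * (u t x - v t x)) =
  \int[mu]_(s in `[0, t]) exchange_gap K u v w s.
suff : forall w, bounded_mfun w -> P w by exact.
apply: (@functional_monotone_class _ R R (@RGenInftyO.G R) P).
- exact: (RGenInftyO.measurableE R).
- move=> _ _ [a ->] [b ->]; exists (Num.min a b).
  apply/seteqP; split => x /=; rewrite !in_itv/= lt_min; first by case=> -> ->.
  by case/andP.
- move=> _ [a ->]; rewrite /P.
  apply: (lim (fun n => gompertz (n%:R ^+ 2) (n%:R - n%:R ^+ 2 * a)) _ 1).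
  + by move=> n; exact: measurable_gompertz.
  + by move=> n x; case/andP: (gompertz_bound (n%:R ^+ 2) (n%:R - n%:R ^+ 2 * a) x) => g0 g1; rewrite ger0_norm.
  + by move=> x; exact: cvg_gompertz_indic.
  + by move=> n; exact: gomp.
(* a constant is a multiple of gompertz 0 0 = exp(-1) *)
- have e0 : gompertz 0 0 =1 cst (expR (-1) : R).
    by move=> x; rewrite /gompertz mul0r addr0 expR0.
  have E : (fun x => (expR 1 - 1) * gompertz 0 0 x + gompertz 0 0 x) = cst (1 : R).
    by apply/funext => x; rewrite e0 /= mulrBl mul1r subrK -expRD subrr expR0.
  have := lin (expR 1 - 1) _ _ (bg 0 0) (bg 0 0) (gomp 0 0) (gomp 0 0).
  rewrite /P -E => <-; apply: eq_Rintegral => x _; congr (_ * _).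
- exact: lin.
- exact: lim.
Qed.

End from_smooth_to_bounded.

(** * Restriction to the half-line *)

Section restriction.
Variable R : realType.
Local Notation X := (measurableTypeR R).
Local Notation mu := (@lebesgue_measure R).
Local Notation integrable f := (mu.-integrable setT (EFin \o f)).

Definition on_pos (f : R -> R) : R -> R := f \_ (Rpos R).

Lemma mem_Rpos (x : R) : (x \in Rpos R) = (0 < x).
Proof.
by apply/idP/idP => [/set_mem|x0]; [|apply/mem_set]; rewrite /Rpos /= in_itv/= andbT.
Qed.

Lemma on_posE (f : R -> R) x : 0 < x -> on_pos f x = f x.
Proof. by move=> x0; rewrite /on_pos patchT// mem_Rpos. Qed.

Lemma on_pos0 (f : R -> R) x : ~~ (0 < x) -> on_pos f x = 0.
Proof. by move=> x0; rewrite /on_pos /patch mem_Rpos (negbTE x0). Qed.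

Lemma in_L1_on_pos (f : R -> R) : in_L1 f -> integrable (on_pos f).
Proof.
move=> fi; have mP : measurable (Rpos R : set X) by exact: measurable_itv.
by have /(integrable_mkcond _ mP) := fi; rewrite restrict_EFin.
Qed.

Lemma on_pos_in_L1 (f : R -> R) : integrable (on_pos f) -> in_L1 f.
Proof.
move=> fi; have mP : measurable (Rpos R : set X) by exact: measurable_itv.
by apply/(integrable_mkcond _ mP); rewrite restrict_EFin.
Qed.

Lemma Rintegral_on_pos (f : R -> R) :
  \int[mu]_(x in Rpos R) f x = \int[mu]_x on_pos f x.
Proof. exact: Rintegral_mkcond. Qed.

Lemma has_moment_on_pos (f : R -> R) : in_L101 f -> has_moment (on_pos f).
Proof.
move=> /in_L1_on_pos fi.
have E x : on_pos f x = on_pos (fun y => (1 + y) * f y) x * (1 + `|x|) `^ (-1).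
  rewrite powR_inv1 ?addr_ge0//.
  have [x0|x0] := boolP (0 < x); last by rewrite !on_pos0// mul0r.
  by rewrite !on_posE// (ger0_norm (ltW x0)) mulrAC mulfV ?mul1r// gt_eqF// addr_gt0.
split.
  rewrite (_ : on_pos f = fun x => on_pos (fun y => (1 + y) * f y) x *
    (1 + `|x|) `^ (-1)); last by apply/funext.
  apply: measurable_funM; first exact: (integrable_measurable fi).
  apply: (@measurableT_comp _ _ _ _ _ _ (fun x : R => x `^ (-1))).
    exact: measurable_powR.
  by apply: measurable_funD => //; exact: measurableT_comp.
have := integrable_normr fi; congr (_.-integrable _ _).
apply/funext => x /=; congr (_%:E).
have [x0|x0] := boolP (0 < x); last by rewrite !on_pos0// normr0 mulr0.
by rewrite !on_posE// normrM (ger0_norm (ltW x0)) ger0_norm// addr_ge0// ltW.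
Qed.

(** Bounded functions act on L^1; this is how weak continuity is used. *)
Lemma L1_dual_pairing (f : R -> R) : bounded_mfun f ->
  L1_dual (fun g : R -> R => \int[mu]_(x in Rpos R) (f x * g x)).
Proof.
move=> bf; have [mf [M fM]] := bf.
have E (g : R -> R) : \int[mu]_(x in Rpos R) (f x * g x) =
    \int[mu]_x (f x * on_pos g x).
  rewrite Rintegral_on_pos; apply: eq_Rintegral => x _.
  have [x0|x0] := boolP (0 < x); last by rewrite !on_pos0// mulr0.
  by rewrite !on_posE.
split.
  move=> a g h /in_L1_on_pos gi /in_L1_on_pos hi; rewrite !E -Rintegral_lin; last 2 first.
  - exact: integrable_bounded_mul.
  - exact: integrable_bounded_mul.
  apply: eq_Rintegral => x _.
  have [x0|x0] := boolP (0 < x); last by rewrite !on_pos0// !mulr0 addr0.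
  by rewrite !on_posE//; ring.
exists M => g gL1; have gi := in_L1_on_pos gL1; rewrite E.
have ni := integrable_normr gi.
have -> : normL1 g = (\int[mu]_x `|on_pos g x|)%:E.
  rewrite /Rintegral fineK; last exact: (integrable_fin_num measurableT ni).
  rewrite /normL1 [LHS]integral_mkcond; apply: eq_integral => x _.
  rewrite /patch mem_Rpos; case: ifPn => x0; first by rewrite on_posE.
  by rewrite on_pos0// normr0.
rewrite -EFinM lee_fin -RintegralZl//.
apply: norm_Rintegral_le.
- by apply: measurable_funM => //; exact: integrable_measurable gi.
- exact: integrable_scale.
- by move=> x; rewrite normrM ler_wpM2r.
Qed.

Lemma weakly_continuous_pairing (z : R -> R -> R) (f : R -> R) :
  weakly_continuous_L1 z -> bounded_mfun f ->
  {within `[0, +oo[, continuous (fun t => \int[mu]_(x in Rpos R) (f x * z t x))}.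
Proof. by move=> [_ zc] bf; exact: zc _ (L1_dual_pairing bf). Qed.

End restriction.

(** * Moments and pairings of weak solutions *)

Section solutions.
Variable R : realType.
Local Notation X := (measurableTypeR R).
Local Notation mu := (@lebesgue_measure R).
Local Notation integrable f := (mu.-integrable setT (EFin \o f)).

(** A right neighbourhood of [t] has positive measure, hence contains times at
which the bound holds. *)
Lemma right_continuous_le (g : R -> R) (C T' : R) :
  {within `[0, +oo[, continuous g} ->
  {ae mu, forall s, 0 < s < T' -> g s <= C} ->
  forall t, 0 <= t -> t < T' -> g t <= C.
Proof.
move=> cg aeC t t0 tT'; rewrite leNgt; apply/negP => Cgt.
have rc : g x @[x --> t^'+] --> g t.
  have [c1 c2] := (continuous_within_itvcyP _ _).1 cg.
  have [->//|tn0] := eqVneq t 0.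
  apply: cvg_at_right_filter; apply: c1.
  by rewrite in_itv/= andbT lt_def tn0.
have near_gt : \forall x \near t^'+, C < g x.
  by apply: (cvgr_gt (g t) rc).
have [del /= del0 Hdel] := near_gt.
pose d := Num.min del (T' - t).
have d0 : 0 < d by rewrite lt_min del0 subr_gt0.
case: aeC => N [mN N0 sN].
have sub : `]t, t + d[ `<=` N.
  move=> s /=; rewrite in_itv/= => /andP[ts std]; apply: sN => /= H.
  have sd : s - t < d by lra.
  have : C < g s.
    apply: Hdel => //=; rewrite ltr0_norm ?subr_lt0// opprB.
    by rewrite (lt_le_trans sd)// ge_min lexx.
  have sT' : s < T'.
    have : d <= T' - t by rewrite ge_min lexx orbT.
    lra.
  by rewrite ltNge H// (le_lt_trans t0 ts) sT'.
have : (mu `]t, (t + d)%R[ <= mu N)%E.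
  by apply: le_measure; rewrite ?inE.
by rewrite N0 lebesgue_measure_itv/= lte_fin ltrDl d0 -EFinB lee_fin; lra.
Qed.

(** Bounded version of the first moment weight, admissible as a functional on
L^1. *)
Definition capped_moment_weight (n : nat) (x : R) : R := Num.min (1 + `|x|) n%:R.

Lemma capped_moment_weight_ge0 n x : 0 <= capped_moment_weight n x.
Proof. by rewrite le_min addr_ge0/=. Qed.

Lemma bounded_capped_moment_weight n : bounded_mfun (capped_moment_weight n).
Proof.
split; first by apply: measurable_minr => //; apply: measurable_funD.
exists n%:R => x; rewrite ger0_norm; first by rewrite ge_min lexx orbT.
by rewrite le_min addr_ge0/=.
Qed.

(** Monotone convergence as the cap is removed. *)
Lemma has_moment_of_capped (f : R -> R) (C : R) : integrable f ->
  (forall n, \int[mu]_x (capped_moment_weight n x * `|f x|) <= C) ->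
  has_moment f /\ moment f <= C.
Proof.
move=> fi HC; have mf := integrable_measurable fi.
pose F n x := (capped_moment_weight n x * `|f x|)%:E.
have mF n : measurable_fun setT (F n : X -> \bar R).
  apply/measurable_EFinP; apply: measurable_funM; last exact: measurableT_comp.
  by have [] := bounded_capped_moment_weight n.
have F0 n x : (0 <= F n x)%E.
  by rewrite lee_fin mulr_ge0 ?capped_moment_weight_ge0 ?abs_on_pos_ge0.
have ndF x : {homo F ^~ x : n m / (n <= m)%N >-> (n <= m)%E}.
  move=> n m nm; rewrite lee_fin ler_wpM2r// /capped_moment_weight.
  by rewrite le_min2// ler_nat.
have FC n : (\int[mu]_x F n x <= C%:E)%E.
  rewrite -[leLHS]fineK; first by rewrite lee_fin; exact: HC.
  apply: (integrable_fin_num measurableT).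
  apply: integrable_bounded_mul; first exact: bounded_capped_moment_weight.
  exact: integrable_normr.
have h := cvg_monotone_convergence (mu := mu) measurableT mF
  (fun n x _ => F0 n x) (fun x _ => ndF x).
have limF x : limn (F ^~ x) = ((1 + `|x|) * `|f x|)%:E.
  apply/cvg_lim => //; apply: cvg_EFin; first exact: nearW.
  apply: cvgMl; apply: cvg_near_cst; near=> n; apply/min_idPl.
  by near: n; exact: nbhs_infty_ger.
have le : (\int[mu]_x ((1 + `|x|) * `|f x|)%:E <= C%:E)%E.
  rewrite (eq_integral (fun x : X => limn (F ^~ x))); last by move=> x _; rewrite limF.
  rewrite -(cvg_lim _ h)//; apply: lime_le; first by apply/cvg_ex; eexists; exact: h.
  exact: nearW.
have hf : has_moment f.
  split => //; apply/integrableP; split.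
    apply/measurable_EFinP; apply: measurable_funM; last exact: measurableT_comp.
    by apply: measurable_funD => //; exact: measurableT_comp.
  rewrite (le_lt_trans _ (ltry C))// (le_trans _ le)//.
  rewrite le_eqVlt; apply/orP; left; apply/eqP; apply: eq_integral => x _ /=.
  by rewrite ger0_norm// mulr_ge0// addr_ge0.
split => //; rewrite -lee_fin /moment /Rintegral fineK//.
by have [_ hi] := hf; exact: (integrable_fin_num measurableT hi).
Unshelve. all: by end_near.
Qed.

(** An everywhere nonnegative and globally measurable representative of an almost
everywhere nonnegative function on the half-line. *)
Definition abs_on_pos (f : R -> R) (x : R) : R := `|on_pos f x|.

Lemma abs_on_pos_ge0 (f : R -> R) x : 0 <= abs_on_pos f x.
Proof. exact: normr_ge0. Qed.

Lemma ae_abs_on_pos (f : R -> R) : ae_nonneg f ->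
  {ae mu, forall x, on_pos f x = abs_on_pos f x}.
Proof.
apply: ae_imply => x f0; rewrite /abs_on_pos.
have [x0|x0] := boolP (0 < x); last by rewrite on_pos0// normr0.
by rewrite on_posE// ger0_norm// f0.
Qed.

Lemma has_moment_abs_on_pos (f : R -> R) : has_moment (on_pos f) ->
  has_moment (abs_on_pos f) /\ moment (abs_on_pos f) = moment (on_pos f).
Proof.
have E : (fun x => (1 + `|x|) * `|abs_on_pos f x|) =
    (fun x => (1 + `|x|) * `|on_pos f x|).
  by apply/funext => x; rewrite normr_id.
move=> [mf fi]; split; last by rewrite /moment E.
by split; [exact: measurableT_comp|rewrite E].
Qed.

Lemma pairing_abs_on_pos (f g : R -> R) : bounded_mfun f -> in_L1 g ->
  ae_nonneg g ->
  \int[mu]_(x in Rpos R) (f x * g x) = \int[mu]_x (f x * abs_on_pos g x).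
Proof.
move=> [mf _] /in_L1_on_pos gi g0; have mg := integrable_measurable gi.
transitivity (\int[mu]_x (f x * on_pos g x)).
  rewrite Rintegral_on_pos; apply: eq_Rintegral => x _.
  have [x0|x0] := boolP (0 < x); last by rewrite !on_pos0// mulr0.
  by rewrite !on_posE.
apply: Rintegral_ae_eq.
- by apply: measurable_funM => //; exact: mg.
- by apply: measurable_funM => //; apply: measurableT_comp => //; exact: mg.
- by apply: ae_imply (ae_abs_on_pos g0) => x ->.
Qed.

Section one_solution.
Variable z : R -> R -> R.
Hypotheses (z_ge0 : forall t, 0 <= t -> ae_nonneg (z t))
  (z_cont : weakly_continuous_L1 z)
  (z_bnd : forall T, 0 < T -> in_Linfty_L101 T z).

(** The bound on the first moment holds at almost every time; for the capped
moments, which are continuous in time, it therefore holds at every time, and the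
cap can be removed at each fixed time. *)
Lemma solution_moment (T : R) : 0 <= T -> exists2 C : R, 0 <= C &
  forall t, 0 <= t <= T ->
    has_moment (abs_on_pos (z t)) /\ moment (abs_on_pos (z t)) <= C.
Proof.
move=> T0; have T1 : 0 < T + 1 by lra.
have [_ _ [C aeC]] := z_bnd T1.
have key n t : 0 <= t <= T ->
    \int[mu]_(x in Rpos R) (capped_moment_weight n x * z t x) <= C.
  move=> /andP[t0 tT].
  have bw := bounded_capped_moment_weight n.
  apply: (@right_continuous_le (fun s => \int[mu]_(x in Rpos R)
      (capped_moment_weight n x * z s x)) C (T + 1)) => //.
  - exact: weakly_continuous_pairing.
  - apply: ae_imply aeC => s /= H s0; have sC := H s0.
    have zL1 : in_L1 (z s) by apply: z_cont.1; case/andP: s0 => /ltW.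
    have zs0 : ae_nonneg (z s) by apply: z_ge0; case/andP: s0 => /ltW.
    rewrite pairing_abs_on_pos//; have zi := in_L1_on_pos zL1.
    rewrite -lee_fin /Rintegral fineK; last first.
      apply: (integrable_fin_num measurableT); apply: integrable_bounded_mul => //.
      exact: integrable_normr.
    apply: le_trans sC; rewrite /normL101 [leRHS]integral_mkcond.
    apply: ge0_le_integral => //.
    - by move=> x _; rewrite lee_fin mulr_ge0 ?capped_moment_weight_ge0 ?abs_on_pos_ge0.
    - apply/measurable_EFinP; apply: measurable_funM; first by have [] := bw.
      by apply: measurableT_comp => //; exact: integrable_measurable zi.
    - rewrite (_ : _ \_ _ = EFin \o (fun x => (1 + `|x|) * `|on_pos (z s) x|)).
        apply/measurable_EFinP; apply: measurable_funM.
          by apply: measurable_funD => //; exact: measurableT_comp.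
        by apply: measurableT_comp => //; exact: integrable_measurable zi.
      apply/funext => x; rewrite /patch mem_Rpos /=; case: ifPn => x0.
        by rewrite on_posE// (ger0_norm (ltW x0)).
      by rewrite on_pos0// normr0 mulr0.
    - move=> x _; rewrite /patch mem_Rpos; case: ifPn => x0.
        rewrite lee_fin /abs_on_pos on_posE// ler_wpM2r//.
        by rewrite ge_min (ger0_norm (ltW x0)) lexx.
      by rewrite /abs_on_pos on_pos0// normr0 mulr0.
  - by rewrite (le_lt_trans tT)// ltrDl.
have C0 : 0 <= C.
  have h0 : (0 : R) <= 0 <= T by rewrite lexx.
  apply: le_trans (key 0%N 0 h0); rewrite pairing_abs_on_pos//.
  - by apply: Rintegral_ge0 => x _; rewrite mulr_ge0 ?capped_moment_weight_ge0 ?abs_on_pos_ge0.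
  - exact: bounded_capped_moment_weight.
  - by apply: z_cont.1.
  - exact: z_ge0.
exists C => // t tT; have t0 : 0 <= t by case/andP: tT.
have zL1 : in_L1 (z t) by exact: z_cont.1.
have zi := integrable_normr (in_L1_on_pos zL1).
apply: has_moment_of_capped => // n.
have -> : \int[mu]_x (capped_moment_weight n x * `|abs_on_pos (z t) x|) =
    \int[mu]_x (capped_moment_weight n x * abs_on_pos (z t) x).
  by apply: eq_Rintegral => x _; rewrite normr_id.
rewrite -pairing_abs_on_pos//; first exact: key.
- exact: bounded_capped_moment_weight.
- exact: z_ge0.
Qed.

(** Pairings with bounded functions are continuous in time. *)
Lemma solution_pairings (T : R) :
  measurable_pairings `[0, T] mu (fun t => abs_on_pos (z t)).
Proof.
move=> f bf.
apply: (@eq_measurable_fun _ _ _ _ _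
    (fun t => \int[mu]_(x in Rpos R) (f x * z t x))).
  move=> t /set_mem; rewrite /= in_itv/= => /andP[t0 _].
  by apply: pairing_abs_on_pos => //; [exact: z_cont.1|exact: z_ge0].
have mc := weakly_continuous_pairing z_cont bf.
have mI : measurable (`[0, +oo[%classic : set R) by exact: measurable_itv.
have h := subspace_continuous_measurable_fun mI mc.
apply: (measurable_funS mI _ h).
by apply: subset_itvl.
Qed.

End one_solution.

End solutions.

(** * The kernel on the whole space *)

Section kernel_extension.
Variable R : realType.
Local Notation X := (measurableTypeR R).
Local Notation mu := (@lebesgue_measure R).
Local Notation mu3 := (prodm mu mu \x mu)%E.

Variables (K : R -> R -> R -> R) (A : R) (phi : R -> R).
Hypotheses (hphi : in_L101 phi)
  (hKmeas : measurable_fun (Rpos R `*` Rpos R `*` Rpos R)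
     (fun p : R * R * R => K p.1.1 p.1.2 p.2))
  (hK0 : forall x y z : R, 0 < x -> 0 < y -> 0 < z -> 0 <= K x y z)
  (hA : 0 <= A)
  (hKle : forall x y z : R, 0 < x -> 0 < y -> 0 < z ->
     K x y z <= A * Num.sqrt (1 + x) * Num.sqrt (1 + y) * phi z).

(** The kernel with the domain of integration 0 < z < x, 0 < y built in, so that
iterated integrals over variable domains become one integral over the whole
space. *)
Definition kernel_ext (p : X * X * X) : R :=
  if (p.2 < p.1.1)%R then
    ((fun p : X * X * X => K p.1.1 p.1.2 p.2) \_ (Rpos R `*` Rpos R `*` Rpos R)) p
  else 0.

Definition rate_ext (z : R) : R := A * `|on_pos phi z|.

Lemma kernel_ext_in (x y z : R) : 0 < y -> 0 < z < x ->
  kernel_ext (x, y, z) = K x y z.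
Proof.
move=> y0 /andP[z0 zx]; rewrite /kernel_ext /= zx patchT// mem_set//.
by split; [split|]; apply: set_mem; rewrite mem_Rpos// (lt_trans z0).
Qed.

Lemma kernel_ext_out (x y z : R) : ~~ ((0 < y) && (0 < z < x)) ->
  kernel_ext (x, y, z) = 0.
Proof.
move=> h; rewrite /kernel_ext /=; case: ifPn => // zx.
rewrite /patch; case: ifPn => // /set_mem [[/= /mem_set]]; rewrite mem_Rpos => x0.
move=> /mem_set; rewrite mem_Rpos => y0 /mem_set; rewrite mem_Rpos => z0.
by rewrite y0 z0 zx in h.
Qed.

Lemma kernel_ext_supp (p : X * X * X) : kernel_ext p != 0 ->
  [/\ 0 < p.1.1, 0 < p.1.2 & 0 < p.2 < p.1.1].
Proof.
case: p => [[x y] z] /=; have [/andP[y0 /andP[z0 zx]] _|h] := boolP ((0 < y) && (0 < z < x)).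
  by split => //; [exact: lt_trans zx|rewrite z0].
by rewrite kernel_ext_out// eqxx.
Qed.

Lemma measurable_kernel_ext : measurable_fun setT kernel_ext.
Proof.
apply: measurable_fun_ifT.
- apply: measurable_fun_ltr; first exact: measurable_snd.
  by apply: (measurableT_comp measurable_fst); exact: measurable_fst.
- have mP : measurable (Rpos R : set X) by exact: measurable_itv.
  have mD : measurable (Rpos R `*` Rpos R `*` Rpos R : set (X * X * X)).
    by apply: measurableX => //; exact: measurableX.
  apply: ((measurable_restrictT _ mD).1 _); exact: hKmeas.
- exact: measurable_cst.
Qed.

Lemma kernel_ext_ge0 p : 0 <= kernel_ext p.
Proof.
have [->//|/kernel_ext_supp] := eqVneq (kernel_ext p) 0.
case: p => [[x y] z] /= [x0 y0 zx]; rewrite kernel_ext_in// hK0//.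
by case/andP: zx.
Qed.

Lemma rate_ext_ge0 z : 0 <= rate_ext z.
Proof. by rewrite mulr_ge0. Qed.

Lemma has_moment_rate_ext : has_moment rate_ext.
Proof.
have [mphi phii] := has_moment_on_pos hphi.
split.
  by apply: measurable_funM => //; exact: measurableT_comp.
have := integrable_scale A phii; congr (_.-integrable _ _).
by apply/funext => z /=; rewrite /rate_ext normrM normr_id (ger0_norm hA) mulrCA.
Qed.

Lemma kernel_ext_le p :
  kernel_ext p <= weight p.1.1 * weight p.1.2 * rate_ext p.2.
Proof.
have [->|/kernel_ext_supp] := eqVneq (kernel_ext p) 0.
  by rewrite mulr_ge0 ?rate_ext_ge0// mulr_ge0 ?weight_ge0.
case: p => [[x y] z] /= [x0 y0 zx]; rewrite kernel_ext_in//.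
have [z0 _] := andP zx; rewrite (le_trans (hKle x0 y0 z0))//.
rewrite /rate_ext on_posE// /weight (ger0_norm (ltW x0)) (ger0_norm (ltW y0)).
rewrite -!mulrA [leRHS]mulrA [leRHS]mulrCA ler_wpM2l// -mulrA.
by rewrite ler_wpM2l ?sqrtr_ge0// ler_wpM2l ?sqrtr_ge0// ler_norm.
Qed.

(** Fubini, the integrand being dominated by an integrable tensor product. *)
Lemma iterated_exchange (w f : R -> R) : bounded_mfun w ->
  has_moment (on_pos f) ->
  (\int[mu]_(x in Rpos R) \int[mu]_(y in Rpos R) \int[mu]_(z in `]0%R, x[)
     (wtilde w x y z * K x y z * f x * f y)%:E
   = (exchange kernel_ext w (on_pos f) (on_pos f))%:E)%E.
Proof.
move=> bw hf.
pose H := exchange_integrand kernel_ext w (on_pos f) (on_pos f).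
have iH : mu3.-integrable setT (EFin \o H).
  exact: (integrable_exchange measurable_kernel_ext kernel_ext_ge0 kernel_ext_le
    has_moment_rate_ext bw hf hf).
rewrite /exchange /Rintegral fineK; last exact: (integrable_fin_num measurableT iH).
have iF := integrable_fubini_F iH.
rewrite -[RHS](integral12_prod_meas1 iH) -[RHS](integral12_prod_meas1 iF) /fubini_F /=.
rewrite [LHS]integral_mkcond; apply: eq_integral => x _.
rewrite /patch mem_Rpos; case: ifPn => x0; last first.
  apply/esym; apply: integral0_eq => y _; apply: integral0_eq => z _.
  by rewrite /H /exchange_integrand /= (on_pos0 f x0) mulr0 mul0r.
rewrite [LHS]integral_mkcond; apply: eq_integral => y _.
rewrite /patch mem_Rpos; case: ifPn => y0; last first.
  apply/esym; apply: integral0_eq => z _.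
  by rewrite /H /exchange_integrand /= (on_pos0 f y0) mulr0.
rewrite [LHS]integral_mkcond; apply: eq_integral => z _.
rewrite /patch; case: ifPn => [/set_mem|].
  rewrite /= in_itv/= => zx.
  by rewrite /H /exchange_integrand /= kernel_ext_in// !on_posE.
move=> zx; rewrite /H /exchange_integrand /= kernel_ext_out ?mulr0 ?mul0r//.
apply: contra zx => /andP[_ zx]; apply: mem_set.
by rewrite /= in_itv.
Qed.

(** Changing a density on a null set changes the form by a quantity bounded by
the half moment of a null function; this avoids tracking exceptional sets inside
the iterated integrals. *)
Lemma exchange_abs_on_pos (w f : R -> R) : bounded_mfun w -> ae_nonneg f ->
  has_moment (on_pos f) ->
  exchange kernel_ext w (on_pos f) (on_pos f) =
  exchange kernel_ext w (abs_on_pos f) (abs_on_pos f).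
Proof.
move=> bw f0 hf; have [hg _] := has_moment_abs_on_pos hf.
have hd := has_momentB hf hg.
have d0 : half_moment (fun x => on_pos f x - abs_on_pos f x) = 0.
  have [md _] := hd.
  rewrite /half_moment (_ : 0 = \int[mu]_x (cst 0 x)); last first.
    by rewrite Rintegral_cst// mul0r.
  apply: Rintegral_ae_eq => //; first exact: measurable_weight_norm.
  by apply: ae_imply (ae_abs_on_pos f0) => x -> /=; rewrite subrr normr0 mulr0.
have [mw [M wM]] := bw.
have lin_l := exchange_linl measurable_kernel_ext kernel_ext_ge0 kernel_ext_le
  has_moment_rate_ext bw hf hg hf.
have lin_r := exchange_linr measurable_kernel_ext kernel_ext_ge0 kernel_ext_le
  has_moment_rate_ext bw hg hf hg.
have bnd := norm_exchange_le measurable_kernel_ext kernel_ext_ge0 kernel_ext_le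
  has_moment_rate_ext mw wM.
have z1 := bnd _ _ hd hf; have z2 := bnd _ _ hg hd.
move: z1 z2; rewrite d0 !mulr0 !mul0r !normr_le0 => /eqP z1 /eqP z2.
by apply/eqP; rewrite -subr_eq0; apply/eqP; lra.
Qed.

End kernel_extension.

(** * Uniqueness of weak solutions *)

Section weak_form.
Variable R : realType.
Local Notation X := (measurableTypeR R).
Local Notation mu := (@lebesgue_measure R).

(** The weak formulation in terms of the trilinear form; the initial datum
contributes a term that is common to all solutions. *)
Lemma weak_solution_identity (K : R -> R -> R -> R) (zin phi : R -> R) (A : R)
    (z : R -> R -> R) :
  in_L101 zin -> in_L101 phi ->
  measurable_fun (Rpos R `*` Rpos R `*` Rpos R)
    (fun p : R * R * R => K p.1.1 p.1.2 p.2) ->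
  (forall x y z : R, 0 < x -> 0 < y -> 0 < z -> 0 <= K x y z) ->
  0 <= A ->
  (forall x y z : R, 0 < x -> 0 < y -> 0 < z ->
    K x y z <= A * Num.sqrt (1 + x) * Num.sqrt (1 + y) * phi z) ->
  weak_solution K zin z ->
  (forall t, 0 <= t -> has_moment (on_pos (z t))) ->
  forall t w, 0 <= t -> smooth_pos w -> bounded_mfun w ->
  \int[mu]_x (w x * abs_on_pos (z t) x) =
  \int[mu]_(x in Rpos R) (w x * zin x) +
  \int[mu]_(s in `[0, t]) exchange (kernel_ext K) w (abs_on_pos (z s)) (abs_on_pos (z s)).
Proof.
move=> hzin hphi mK K0 A0 Kle [z0 zc _ zeq] zm t w t0 sw bw.
have wLinfty : in_Linfty w.
  have [mw [M wM]] := bw; split; first exact: measurable_funTS.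
  by exists M; apply: aeW => x _.
have zL1 : in_L1 (z t) by exact: zc.1.
have zinL1 : in_L1 zin.
  have := has_moment_integrable (has_moment_on_pos hzin).
  by move=> h; apply: on_pos_in_L1.
rewrite -(pairing_abs_on_pos bw zL1 (z0 t t0)).
have [lin _] := L1_dual_pairing bw.
have := lin (-1) zin (z t) zinL1 zL1.
have -> : \int[mu]_(x in Rpos R) (w x * (-1 * zin x + z t x)) =
    \int[mu]_(x in Rpos R) (w x * (z t x - zin x)).
  by apply: eq_Rintegral => x _; ring.
have -> : \int[mu]_(x in Rpos R) (w x * (z t x - zin x)) =
    \int[mu]_(s in `[0, t]) exchange (kernel_ext K) w (abs_on_pos (z s)) (abs_on_pos (z s)).
  rewrite {1}/Rintegral (zeq t w t0 sw wLinfty); congr fine.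
  apply: eq_integral => s /set_mem; rewrite /= in_itv/= => /andP[s0 _].
  rewrite (iterated_exchange hphi mK K0 A0 Kle bw (zm s s0)).
  by rewrite (exchange_abs_on_pos hphi mK K0 A0 Kle bw (z0 s s0) (zm s s0)).
by move=> ->; ring.
Qed.

End weak_form.

Unset Implicit Arguments.
Set Strict Implicit.

Theorem theorem2p5 (R : realType) (zin phi : R -> R)
    (K : R -> R -> R -> R) (A : R) (zeta : R -> R -> R)
    (hzin : in_L101 zin) (hzin0 : ae_nonneg zin)
    (hphi : in_L101 phi)
    (hKmeas : measurable_fun (Rpos R `*` Rpos R `*` Rpos R)
                (fun p : R * R * R => K p.1.1 p.1.2 p.2))
    (hK0 : forall x y z : R, 0 < x -> 0 < y -> 0 < z -> 0 <= K x y z)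
    (hKsupp : forall x y z : R, 0 < x -> 0 < y -> 0 < z ->
                x < z -> K x y z = 0)
    (hA : 0 <= A)
    (hKle : forall x y z : R, 0 < x -> 0 < y -> 0 < z ->
              K x y z <= A * Num.sqrt (1 + x) * Num.sqrt (1 + y) * phi z)
    (hzeta : weak_solution K zin zeta) :
  forall xi : R -> R -> R, weak_solution K zin xi ->
    forall t : R, 0 <= t -> ae_eq_pos (xi t) (zeta t).
Proof.
move=> xi hxi T T0.
have [xi0 xic xib _] := hxi; have [zeta0 zetac zetab _] := hzeta.
have moments (z : R -> R -> R) : weak_solution K zin z ->
    forall t, 0 <= t -> has_moment (on_pos (z t)).
  move=> [z0 zc zb _] t t0.
  have [C _ /(_ t)] := solution_moment z0 zc zb t0.
  rewrite t0 lexx => /(_ isT) [[_ hi] _]; split.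
    exact: integrable_measurable (in_L1_on_pos (zc.1 t t0)).
  by move: hi; congr (_.-integrable _ _); apply/funext => x /=; rewrite normr_id.
have [C1 C10 HC1] := solution_moment xi0 xic xib T0.
have [C2 C20 HC2] := solution_moment zeta0 zetac zetab T0.
pose C := C1 + C2.
pose u t := abs_on_pos (xi t); pose v t := abs_on_pos (zeta t).
have hu t : 0 <= t <= T -> has_moment (u t) by move=> /HC1[].
have hv t : 0 <= t <= T -> has_moment (v t) by move=> /HC2[].
have uC t : 0 <= t <= T -> moment (u t) <= C.
  by move=> /HC1[_ h]; rewrite (le_trans h)// lerDl.
have vC t : 0 <= t <= T -> moment (v t) <= C.
  by move=> /HC2[_ h]; rewrite (le_trans h)// lerDr.
have pu := @solution_pairings _ xi xi0 xic T.
have pv := @solution_pairings _ zeta zeta0 zetac T.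
have mK := measurable_kernel_ext hKmeas.
have K0 := kernel_ext_ge0 hK0.
have Kle := kernel_ext_le hA hKle.
have hc := has_moment_rate_ext hphi hA.
have c0 := rate_ext_ge0 phi hA.
have smooth_eq t (w : R -> R) : 0 <= t <= T -> smooth_pos w ->
    measurable_fun setT w -> (forall x, 0 <= w x <= 1) ->
    \int[lebesgue_measure]_x (w x * (u t x - v t x)) =
    \int[lebesgue_measure]_(s in `[0, t]) exchange_gap (kernel_ext K) u v w s.
  move=> tT sw mw w01; have /andP[t0 _] := tT.
  have bw : bounded_mfun w.
    by split => //; exists 1 => x; case/andP: (w01 x) => wx0 wx1; rewrite ger0_norm.
  have equ := weak_solution_identity hzin hphi hKmeas hK0 hA hKle hxi (moments _ hxi) t0 sw bw.
  have eqv := weak_solution_identity hzin hphi hKmeas hK0 hA hKle hzeta (moments _ hzeta) t0 sw bw.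
  have ui := integrable_exchange_in_time mK K0 Kle hc c0 T0 hu uC pu bw tT.
  have vi := integrable_exchange_in_time mK K0 Kle hc c0 T0 hv vC pv bw tT.
  have mI : measurable (`[0, t]%classic : set (measurableTypeR R)) by exact: measurable_itv.
  rewrite [RHS](RintegralB mI ui vi).
  transitivity (\int[lebesgue_measure]_x (w x * u t x) - \int[lebesgue_measure]_x (w x * v t x)).
    rewrite -RintegralB//; last 2 first.
    - by apply: integrable_bounded_mul => //; exact: has_moment_integrable (hu t tT).
    - by apply: integrable_bounded_mul => //; exact: has_moment_integrable (hv t tT).
    by apply: eq_Rintegral => x _; rewrite mulrBr.
  by rewrite equ eqv opprD addrACA subrr add0r.
have weak := weak_eq_bounded mK K0 Kle hc c0 T0 hu hv uC vC pu pv smooth_eq.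
have gap0 := half_moment_gap_eq0 mK K0 (@kernel_ext_supp _ K) Kle hc c0 T0 hu hv
  (fun t => abs_on_pos_ge0 (xi t)) (fun t => abs_on_pos_ge0 (zeta t)) uC vC pu pv weak.
have TT : 0 <= T <= T by rewrite T0 lexx.
have hE := has_momentB (hu T TT) (hv T TT).
have wi := has_moment_weight hE.
have : {ae lebesgue_measure, forall x, weight x * (u T x - v T x) = 0}.
  apply: Rintegral_norm_eq0 => //; rewrite -[RHS]gap0; apply: eq_Rintegral => x _.
  by rewrite normrM (ger0_norm (weight_ge0 x)).
move=> E0; rewrite /ae_eq_pos.
have E1 := ae_imply2 (fun x a b => conj a b) (ae_abs_on_pos (xi0 T T0)) (ae_abs_on_pos (zeta0 T T0)).
apply: ae_imply2 E0 E1 => x /eqP + [xE zE] x0.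
rewrite mulf_eq0 gt_eqF ?weight_gt0//= subr_eq0 => /eqP.
by rewrite /u /v -xE -zE !on_posE.
Qed.
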